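(* Let $A=\{1,\ldots,s\}$ and let $P$ be an attractive continuous probability kernel on $A$. If there exists a unique stationary chain compatible with $P$, then there exists a feasible CFTP algorithm using a countable alphabet i.i.d. process that simulates this chain. That is, there exist a countable set $\mathcal{U}$, an i.i.d. process ${\bf U}=\{U_i\}_{i\in\mathbb{Z}}$ with values in $\mathcal{U}$ and law $\mathbb{P}$, a measurable shift-commuting map $\Phi:\mathcal{U}^{\mathbb{Z}}\to A^{\mathbb{Z}}$ and a $\mathbb{P}$-a.s. finite map $\theta:\mathcal{U}^{\mathbb{Z}}\to\{0,1,2,\ldots\}\cup\{\infty\}$ such that: $\Phi({\bf U})$ has the law of the unique stationary chain compatible with $P$; for every finite $k\ge 0$ the event $\{\theta({\bf U})=k\}$ is measurable with respect to $\sigma(U_{-k},\ldots,U_0)$; and $[\Phi({\bf U})]_0=[\Phi({\bf V})]_0$ whenever $U_i=V_i$ for all $-\theta({\bf U})\le i\le 0$.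
   Context: $A=\{1,2,\ldots,s\}$ is a finite ordered set. A past is $\underline{x}=x_{-1}x_{-2}\ldots\in A^{-\mathbb{N}}$; for $a_{-k}^{-1}=a_{-1}\ldots a_{-k}$, $a_{-k}^{-1}\underline{x}$ is the past obtained by concatenation, whose most recent symbols are $a_{-1},\ldots,a_{-k}$. Pasts are partially ordered by $\underline{x}\le\underline{y}$ iff $x_{-i}\le y_{-i}$ for all $i\ge1$. A probability kernel on $A$ is a function $P:A\times A^{-\mathbb{N}}\to[0,1]$ with $\sum_{a\in A}P(a|\underline{x})=1$ for all $\underline{x}$. It is continuous if $\mathrm{var}_k:=\sup_{b\in A}\sup_{a_{-k}^{-1}}\sup_{\underline{x},\underline{y}}|P(b|a_{-k}^{-1}\underline{x})-P(b|a_{-k}^{-1}\underline{y})|\to0$ as $k\to\infty$. It is attractive if for every $a\in A$ the map $\underline{x}\mapsto\sum_{j\ge a}P(j|\underline{x})$ is increasing (i.e. non-decreasing) with respect to the partial order on pasts. A stationary chain $\{X_j\}_{j\in\mathbb{Z}}$ on $A$ with law $\mu$ is compatible with $P$ if $\mu(X_0=a|X_{-\infty}^{-1}=\underline{x})=P(a|\underline{x})$ for every $a\in A$ and $\mu$-a.e. $\underline{x}$. Uniqueness refers to the law of the stationary chain. CFTP stands for coupling-from-the-past: an algorithm constructing the value of the chain at time $0$ from a finite (random) number of past values of an i.i.d. process; it is feasible if its stopping time $\theta$ is a.s. finite. The precise meaning is spelled out in the claim. *)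

(* Defs.v *)
From HB Require Import structures.
From mathcomp Require Import all_boot all_order all_algebra.
From mathcomp Require Import finmap.
From mathcomp Require Import all_classical all_reals all_analysis.

Set Implicit Arguments.
Unset Strict Implicit.
Unset Printing Implicit Defensive.
Import Order.TTheory GRing.Theory Num.Theory.
Import numFieldNormedType.Exports.
Local Open Scope classical_set_scope.
Local Open Scope ring_scope.

(* The events that depend on a single coordinate [i] in [J].  The alphabet
   carries the discrete sigma-algebra (it is always countable below), hence
   [<<s coord_events J >>] is the sigma-algebra sigma(X_i, i in J). *)
Definition coord_events {I : Type} {T : pointedType} (J : set I) :
    set (set (I -> T)) :=
  \bigcup_(i in J)
    preimage_set_system setT (fun w : I -> T => w i) discrete_measurable.

Definition seq_space (I : Type) (T : pointedType) :=
  g_sigma_algebraType (@coord_events I T setT).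

Definition path_shift {T : Type} (w : int -> T) : int -> T := fun i => w (i + 1).

HB.instance Definition _ m := isPointed.Build 'I_m.+1 ord0.

(* The alphabet {1 < ... < s} with s = m.+1, relabelled {0 < ... < m}. *)
Notation alphabet m := 'I_m.+1.

(* A past x_{-1} x_{-2} ... is encoded as n |-> x_{-(n+1)}. *)
Definition pasts (m : nat) := seq_space nat (alphabet m).

Definition paths (m : nat) := seq_space int (alphabet m).

Definition past_of {m : nat} (w : paths m) : pasts m := fun n => w (- n.+1%:Z).

(* The past whose [k] most recent symbols are a_{-1} ... a_{-k} (stored in this
   order in the tuple), followed by x. *)
Definition cat_past {m k : nat} (a : k.-tuple (alphabet m)) (x : pasts m) :
    pasts m :=
  fun n => nth (x (n - k)%N) a n.

Section kernels.
Context {R : realType} {m : nat}.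
Implicit Type P : alphabet m -> pasts m -> R.

Definition is_kernel P : Prop :=
  (forall a x, 0 <= P a x <= 1) /\ (forall x, \sum_(a : alphabet m) P a x = 1).

Definition kernel_var P (k : nat) : R :=
  sup [set r | exists (b : alphabet m) (a : k.-tuple (alphabet m))
                      (x y : pasts m),
                 r = `|P b (cat_past a x) - P b (cat_past a y)|].

Definition continuous_kernel P : Prop := kernel_var P k @[k --> \oo] --> 0.

Definition past_le (x y : pasts m) : Prop := forall n, (x n <= y n)%N.

Definition attractive P : Prop :=
  forall (a : alphabet m) (x y : pasts m), past_le x y ->
    \sum_(j : alphabet m | (a <= j)%N) P j x
      <= \sum_(j : alphabet m | (a <= j)%N) P j y.

(* A stationary chain is identified with its law [mu] on the path space. *)

Implicit Type mu : probability (paths m) R.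

Definition stationary mu : Prop :=
  forall B : set (paths m), measurable B -> mu (path_shift @^-1` B) = mu B.

(* [g] is a version of x |-> mu(X_0 = a | X_{-oo}^{-1} = x). *)
Definition conditional_version mu (a : alphabet m) (g : pasts m -> R) : Prop :=
  measurable_fun setT g /\
  forall B : set (pasts m), measurable B ->
    mu ([set w : paths m | w 0 = a] `&` past_of @^-1` B)
    = (\int[mu]_(w in past_of @^-1` B) (g (past_of w))%:E)%E.

Definition compatible P mu : Prop :=
  forall a : alphabet m, exists2 g : pasts m -> R,
    conditional_version mu a g &
    {ae mu, forall w : paths m, g (past_of w) = P a (past_of w)}.

Definition unique_compatible_chain P mu : Prop :=
  [/\ stationary mu, compatible P mu &
      forall nu : probability (paths m) R,
        stationary nu -> compatible P nu ->
        forall B : set (paths m), measurable B -> nu B = mu B].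

End kernels.

Section cftp.
Context {R : realType} {U : pointedType}.

Definition iid_law (Q : probability (seq_space int U) R) : Prop :=
  (forall (i : int) (B : set U),
      Q [set u : int -> U | B (u i)] = Q [set u : int -> U | B (u 0)]) /\
  (forall (J : {fset int}) (B : int -> set U),
      Q [set u : int -> U | forall i, i \in J -> B i (u i)]
      = (\prod_(i <- J) Q [set u : int -> U | B i (u i)])%E).

(* The times -t <= i <= 0, where [None] encodes t = oo (all i <= 0). *)
Definition window (t : option nat) : set int :=
  [set i : int | i <= 0 /\ if t is Some k then - k%:Z <= i else True].

Record feasible_cftp (m : nat) (Q : probability (seq_space int U) R)
    (Phi : seq_space int U -> paths m) (theta : seq_space int U -> option nat)
    (mu : probability (paths m) R) : Prop := FeasibleCFTP {
  cftp_measurable : measurable_fun setT Phi ;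
  cftp_shift : forall u : seq_space int U, Phi (path_shift u) = path_shift (Phi u) ;
  cftp_law : forall B : set (paths m), measurable B ->
    Q (Phi @^-1` B) = mu B ;
  cftp_feasible : {ae Q, forall u : seq_space int U, theta u <> None} ;
  cftp_stopping : forall k : nat,
    <<s coord_events (window (Some k)) >>
      [set u : int -> U | theta u = Some k] ;
  cftp_local : forall u v : seq_space int U,
    (forall i, window (theta u) i -> u i = v i) -> Phi u 0 = Phi v 0 }.

End cftp.

(* Main.v *)
Require Import Defs.
From HB Require Import structures.
From mathcomp Require Import all_boot all_order all_algebra.
From mathcomp Require Import finmap.
From mathcomp Require Import all_classical all_reals all_analysis.
From mathcomp Require Import measurable_realfun ring lra.

Set Implicit Arguments.
Unset Strict Implicit.
Unset Printing Implicit Defensive.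
Import Order.TTheory GRing.Theory Num.Theory.
Import numFieldNormedType.Exports.
Local Open Scope classical_set_scope.
Local Open Scope ring_scope.

(** Write G_a(x) for the sum of P(j|x) over j >= a.  If V is uniform on the unit
interval, the largest letter a with V <= G_a(x) has law P(.|x), and since P is
attractive this letter is a nondecreasing function of the past x.  Let
independent uniform variables V_t drive the chain that starts at time -n from
the past made of maximal letters.  Its value at a fixed time decreases as n
grows, so it becomes constant; by continuity of P the limit w solves
w_t = F(V_t, past of w at t) for all t, hence it is stationary and compatible
with P ([chain_law_stationary], [chain_law_compatible]).  The same holds from
below, starting from minimal letters.  By uniqueness the two limits have the
same law mu, and one dominates the other, so they are almost surely equal
([low_eq_up_ae]).  Hence almost surely the two chains started at time -n agree
at time 0 for some finite n; the first such n is the stopping time, and the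
limit is squeezed between the two chains ([up_at_coalescence]).

A uniform variable has infinitely many binary digits, which no symbol of a
countable alphabet can hold.  The digits are therefore supplied by earlier
symbols.  A symbol holds a random level l and a table of fair bits, indexed by a
delay d < 4^(l+1) and a rank k <= l; the digit of rank k of V_t is the entry
(d, k) of the most recent symbol u_(t-d) whose table has such an entry.  The
level l has probability at least 2^-(l+1), so that among the 4^(l+1) symbols that
would serve the digit if they had level l, one has this level except with
probability at most 2^-(l+1), for every l >= k; almost surely every digit has a
source ([symbol_law_unsourced]).  Sources are determined by the levels alone and
distinct digits read distinct entries, so the digits are again independent fair
bits ([fair_allocated_bits]).

With only the symbols of times -n, ..., 0 at hand, finitely many digits are
known.  The unknown ones are replaced by 0 for the upper chain and by 1 for the
lower chain.  This pushes the chains apart, and monotonically less so as n grows,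
so it preserves the squeezing; it does not change the limits, because these are
the extremal solutions of the equation above ([stage_cvg]).

The upper and the lower chain are treated together: [h] maps letters to numbers
so that each chain decreases along [h] to its limit, [r] is the order along which
its digits converge, [e] is the letter it starts from and [dflt] stands for an
unknown digit. *)

(** * Sequence spaces and independence *)

Lemma coord_measurable (I : Type) (T : pointedType) (i : I) (B : set T) :
  measurable [set z : seq_space I T | B (z i)].
Proof.
apply: sub_sigma_algebra; exists i => //; exists B => //.
by rewrite setTI.
Qed.

(** Fixing the coordinates one at a time writes the set as a countable union of
cylinders, so whatever is computed from finitely many symbols is measurable,
even through comparisons of arbitrary real numbers. *)
Lemma finite_coords_measurable (I : Type) (T : pointedType) (js : seq I)
    (A : set (seq_space I T)) :
  countable [set: T] ->
  (forall u v, [seq u j | j <- js] = [seq v j | j <- js] -> A u -> A v) ->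
  measurable A.
Proof.
move=> cT; elim: js A => [|j js IH] A Ajs.
  have [->|/set0P[u Au]] := eqVneq A set0; first exact: measurable0.
  rewrite (_ : A = setT); first exact: measurableT.
  by apply/seteqP; split=> // v _; exact: Ajs Au.
(* the constraint imposed on the remaining coordinates once u j is c *)
pose Ac c := [set u : seq_space I T | exists v,
  [/\ v j = c, [seq v j | j <- js] = [seq u j | j <- js] & A v]].
rewrite (_ : A = \bigcup_c ([set u | u j = c] `&` Ac c)); last first.
  apply/seteqP; split=> [u Au|u [c _ [<- [v [vj vjs Av]]]]].
    by exists (u j) => //; split=> //; exists u.
  by apply: Ajs Av => /=; rewrite vj vjs.
apply: countable_bigcupT_measurable => // c; apply: measurableI.
  exact: (@coord_measurable I T j (fun t => t = c)).
apply: IH => u v uv [w [wj wjs Aw]]; exists w; split=> //.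
by rewrite wjs.
Qed.

Lemma measurable_seq_space d (T' : measurableType d) (I : Type)
    (T : pointedType) (f : T' -> seq_space I T) :
  countable [set: T] ->
  (forall i c, measurable [set w | f w i = c]) -> measurable_fun setT f.
Proof.
move=> cT mf.
apply: (@measurability _ _ _ (seq_space I T) setT _ (@coord_events I T setT))
  => //.
move=> _ [_ [i _ [B _ <-]] <-]; rewrite !setTI.
rewrite (_ : _ @^-1` _ = \bigcup_(c in B) [set w | f w i = c]); last first.
  by apply/seteqP; split=> [w Bw|w [c Bc fc]]; [exists (f w i)|rewrite /= fc].
rewrite bigcup_mkcond; apply: countable_bigcupT_measurable => // c.
by case: ifP => _ //; exact: mf.
Qed.

(** Overwriting the coordinates outside J by a constant is measurable from
sigma(J) and leaves membership in A unchanged.  This turns locality, which is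
visible on the constructions below, into measurability. *)
Lemma local_sigma (I : Type) (T : pointedType) (J : set I)
    (A : set (seq_space I T)) :
  measurable A -> (forall u v, (forall i, J i -> u i = v i) -> A u -> A v) ->
  <<s coord_events J >> A.
Proof.
move=> mA AJ.
(* r forgets the coordinates outside J *)
pose r (z : I -> T) : I -> T := fun i => if pselect (J i) then z i else point.
have rJ z i : J i -> r z i = z i by rewrite /r; case: pselect.
rewrite (_ : A = r @^-1` A); last first.
  by apply/seteqP; split=> z; apply: AJ => i Ji; rewrite rJ.
suff mr : measurable_fun setT
    (r : g_sigma_algebraType (@coord_events I T J) -> seq_space I T).
  by have := mr measurableT _ mA; rewrite setTI.
apply: (@measurability _ _ _ (seq_space I T) setT _ (@coord_events I T setT)) => //.
move=> _ [_ [i _ [B _ <-]] <-]; rewrite !setTI.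
have [Ji|nJi] := pselect (J i).
  apply: sub_sigma_algebra; exists i => //; exists B => //; rewrite setTI.
  by apply/seteqP; split=> z /=; rewrite rJ.
have rE z : r z i = point by rewrite /r; case: pselect.
rewrite (_ : _ @^-1` _ = [set _ | B point]).
  by have [Bp|nBp] := pselect (B point);
    [rewrite (_ : mkset _ = setT)|rewrite (_ : mkset _ = set0)];
    rewrite // -?subTset// -?subset0 => z.
by apply/seteqP; split=> z /=; rewrite rE.
Qed.

Section independence.
Context {d} {T : measurableType d} {R : realType} (P : probability T R).

Lemma indep_lambda_system (B : set T) : measurable B ->
  lambda_system setT
    [set A | measurable A /\ P (A `&` B) = (P A * P B)%E].
Proof.
move=> mB; split=> //=.
- by split=> //; rewrite setTI probability_setT mul1e.
- move=> A1 A2 A21 [mA1 E1] [mA2 E2]; split; first exact: measurableD.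
  rewrite (_ : _ `&` B = (A1 `&` B) `\` (A2 `&` B)); last first.
    apply/seteqP; split=> x /=; first by move=> [[A1x nA2x] Bx]; split=> // -[].
    by move=> [[A1x Bx] nA2B]; split=> //; split=> // A2x; exact: nA2B.
  rewrite measureD; last 3 first.
  - exact: measurableI.
  - exact: measurableI.
  - by rewrite ltey_eq fin_num_measure//; exact: measurableI.
  rewrite measureD//; last by rewrite ltey_eq fin_num_measure.
  rewrite setIACA setIid (setIidr A21).
  rewrite /= E1 E2 muleBl ?fin_num_measure//.
  by rewrite fin_num_adde_defr// fin_num_measure.
- move=> F ndF mF; split.
    by apply: bigcup_measurable => n _; have [] := mF n.
  have cv1 : (P (F n `&` B) @[n --> \oo] --> P ((\bigcup_n F n) `&` B))%E.
    rewrite setI_bigcupl; apply: nondecreasing_cvg_mu.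
    - by move=> n; apply: measurableI => //; have [] := mF n.
    - by apply: bigcup_measurable => n _; apply: measurableI => //; have [] := mF n.
    - by move=> n k nk; apply/subsetPset; apply: setSI; apply/subsetPset; exact: ndF.
  have cv2 : (P (F n) * P B @[n --> \oo] --> P (\bigcup_n F n) * P B)%E.
    apply: cvgeZr; first by rewrite fin_num_measure.
    apply: nondecreasing_cvg_mu => //.
    - by move=> n; have [] := mF n.
    - by apply: bigcup_measurable => n _; have [] := mF n.
  rewrite -(cvg_lim _ cv1)// -(cvg_lim _ cv2)//; congr (limn _).
  by apply/funext => n; have [] := mF n.
Qed.

(** Dynkin's pi-lambda theorem is applied to one factor at a time. *)
Lemma indep_pi_systems (G1 G2 : set (set T)) :
  setI_closed G1 -> setI_closed G2 ->
  G1 `<=` measurable -> G2 `<=` measurable ->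
  (forall A B, G1 A -> G2 B -> P (A `&` B) = (P A * P B)%E) ->
  forall A B, <<s G1 >> A -> <<s G2 >> B -> P (A `&` B) = (P A * P B)%E.
Proof.
move=> G1I G2I mG1 mG2 G12.
have step1 A B : <<s G1 >> A -> G2 B -> measurable A /\ P (A `&` B) = (P A * P B)%E.
  move=> sA G2B.
  have := @lambda_system_subset _ _ G1I setT _ (indep_lambda_system (mG2 _ G2B)).
  by apply=> // C G1C; split; [exact: mG1|exact: G12].
move=> A B sA sB.
have mA : measurable A.
  by move: sA; apply: smallest_sub => //; exact: sigma_algebra_measurable.
have := @lambda_system_subset _ _ G2I setT _ (indep_lambda_system mA).
move=> /(_ _ _ B sB) [] //.
  move=> C G2C; split; first exact: mG2.
  by rewrite setIC (step1 A C sA G2C).2 muleC.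
by move=> _; rewrite setIC muleC.
Qed.

End independence.

(** * Fair coins *)

Definition image_law {d d'} {T : measurableType d} {T' : measurableType d'}
    {R : realType} (P : probability T R) (f : T -> T')
    (mf : measurable_fun setT f) : probability T' R :=
  distribution P (mfun_Sub (mem_set mf)).

Lemma image_lawE d d' (T : measurableType d) (T' : measurableType d')
    (R : realType) (P : probability T R) (f : T -> T')
    (mf : measurable_fun setT f) (A : set T') :
  image_law P mf A = P (f @^-1` A).
Proof. by []. Qed.

Definition cylinder {I : choiceType} (F : {fset I}) (e : I -> bool) :
    set (seq_space I bool) :=
  [set z | forall i, i \in F -> z i = e i].

(** The empty set makes the family stable under intersection, as two cylinders
may prescribe different values at a common coordinate. *)
Definition cylinders {I : choiceType} (J : set I) : set (set (seq_space I bool)) :=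
  [set A | A = set0 \/ exists (F : {fset I}) e,
    (forall i, i \in F -> J i) /\ A = cylinder F e].

Lemma measurable_cylinder (I : choiceType) (F : {fset I}) e :
  measurable (@cylinder I F e).
Proof.
apply: (@finite_coords_measurable I bool (enum_fset F)); first exact: countableP.
move=> u v uv uF i iF.
rewrite -uF//; have := congr1 (nth false ^~ (index i (enum_fset F))) uv.
by rewrite !(nth_map i) ?index_mem// nth_index.
Qed.

Lemma cylinders_setI (I : choiceType) (J : set I) : setI_closed (cylinders J).
Proof.
move=> _ _ [->|[F [e [FJ ->]]]] [->|[F' [e' [F'J ->]]]];
  rewrite ?set0I ?setI0; try by left.
have [agr|/existsNP[i /not_implyP[iF /not_implyP[iF' ne]]]] :=
    pselect (forall i, i \in F -> i \in F' -> e i = e' i); last first.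
  left; apply/seteqP; split=> // z [zF zF']; apply: ne.
  by rewrite -zF// zF'.
right; exists (F `|` F')%fset, (fun i => if i \in F then e i else e' i); split.
  by move=> i /fsetUP[/FJ|/F'J].
apply/seteqP; split=> z.
  move=> [zF zF'] i /fsetUP[iF|iF']; first by rewrite iF zF.
  by case: ifPn => iF; [rewrite zF|rewrite zF'].
move=> zU; split=> i iF; rewrite zU ?in_fsetU ?iF ?orbT//.
by case: ifPn => // iF0; exact: agr.
Qed.

Lemma cylinders_measurable (I : choiceType) (J : set I) :
  cylinders J `<=` measurable.
Proof.
move=> _ [->|[F [e [_ ->]]]]; first exact: measurable0.
exact: measurable_cylinder.
Qed.

Lemma coord_events_cylinders (I : choiceType) (J : set I) :
  <<s @coord_events I bool J >> `<=` <<s cylinders J >>.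
Proof.
apply: smallest_sub; first exact: smallest_sigma_algebra.
move=> _ [i Ji [B _ <-]]; rewrite setTI.
rewrite (_ : _ @^-1` _ = \bigcup_(b in B) [set w : I -> bool | w i = b]); last first.
  by apply/seteqP; split=> [w Bw|w [c Bc wc]]; [exists (w i)|rewrite /= wc].
rewrite bigcup_mkcond.
apply: (@countable_bigcupT_measurable _ (g_sigma_algebraType (cylinders J))).
  exact: countableP.
move=> b; case: ifP => _; last exact: measurable0.
apply: sub_sigma_algebra; right; exists [fset i]%fset, (fun=> b); split.
  by move=> j; rewrite inE => /eqP ->.
apply/seteqP; split=> w /= wb; last by apply: wb; rewrite inE.
by move=> j; rewrite inE => /eqP ->.
Qed.

Section fair_bits.
Context {R : realType}.

Definition fair {I : choiceType} (nu : probability (seq_space I bool) R) :=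
  forall (F : {fset I}) e, nu (cylinder F e) = ((2^-1) ^+ #|` F|)%:E.

Lemma fair_unique (I : choiceType) (nu1 nu2 : probability (seq_space I bool) R) :
  fair nu1 -> fair nu2 -> forall A, measurable A -> nu1 A = nu2 A.
Proof.
move=> f1 f2 A mA.
apply: (@measure_unique _ _ _ (@cylinders I setT) (fun=> setT)) => //.
- apply/seteqP; split; first exact: coord_events_cylinders.
  apply: smallest_sub; first exact: sigma_algebra_measurable.
  exact: cylinders_measurable.
- exact: cylinders_setI.
- move=> _; right; exists fset0, (fun=> true); split=> //.
  by apply/seteqP; split=> z.
- by apply/seteqP; split=> // z _; exists 0%N.
- move=> _ [->|[F [e [_ ->]]]]; first by rewrite !measure0.
  exact: etrans (f1 _ _) (esym (f2 _ _)).
- by move=> _; apply: le_lt_trans (probability_le1 _ _) _; rewrite // ltry.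
Qed.

(** Cylinders over disjoint sets of coordinates glue to a cylinder, whose
probability is the product; the pi-lambda theorem does the rest. *)
Lemma fair_indep (I : choiceType) (nu : probability (seq_space I bool) R)
    (J1 J2 : set I) (A B : set (seq_space I bool)) :
  fair nu -> (forall i, J1 i -> J2 i -> False) ->
  measurable A -> (forall u v, (forall i, J1 i -> u i = v i) -> A u -> A v) ->
  measurable B -> (forall u v, (forall i, J2 i -> u i = v i) -> B u -> B v) ->
  nu (A `&` B) = (nu A * nu B)%E.
Proof.
move=> fnu J12 mA AJ mB BJ.
apply: (@indep_pi_systems _ _ _ nu (cylinders J1) (cylinders J2)).
- exact: cylinders_setI.
- exact: cylinders_setI.
- exact: cylinders_measurable.
- exact: cylinders_measurable.
- move=> _ _ [->|[F [e [FJ ->]]]] [->|[F' [e' [F'J ->]]]];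
    rewrite ?set0I ?setI0 ?measure0 ?mul0e ?mule0//.
  have FF' : [disjoint F & F']%fset.
    by apply/fdisjointP => i iF; apply/negP => /F'J; exact/J12/FJ.
  rewrite (_ : _ `&` _ = cylinder (F `|` F')%fset
      (fun i => if i \in F then e i else e' i)); last first.
    apply/seteqP; split=> z.
      move=> [zF zF'] i /fsetUP[iF|iF']; first by rewrite iF zF.
      by case: ifPn => iF; [rewrite zF|rewrite zF'].
    move=> zU; split=> i iF; rewrite zU ?in_fsetU ?iF ?orbT//.
    by case: ifPn => // /(fdisjointP FF'); rewrite iF.
  by rewrite !fnu -EFinM -exprD cardfsU (eqP FF') cardfs0 subn0.
- by apply: coord_events_cylinders; apply: local_sigma.
- by apply: coord_events_cylinders; apply: local_sigma.
Qed.

Lemma measurable_reindex (I I' : choiceType) (f : I' -> I) :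
  measurable_fun setT
    (fun (z : seq_space I bool) => (fun i => z (f i)) : seq_space I' bool).
Proof.
apply: measurable_seq_space; first exact: countableP.
move=> i c.
exact: (@coord_measurable _ _ (f i) (fun b => b = c)).
Qed.

Lemma fair_reindex (I I' : choiceType) (f : I' -> I)
    (nu : probability (seq_space I bool) R) :
  injective f -> fair nu ->
  forall F e, nu [set z | forall i, i \in F -> z (f i) = e i]
    = ((2^-1) ^+ #|` F|)%:E.
Proof.
move=> finj fnu F e.
(* e is transported along f, consistently since f is injective *)
rewrite (_ : mkset _ = cylinder (f @` F)%fset
    (fun k => `[< exists2 i, f i = k & e i >])).
  by rewrite fnu card_imfset.
have eE i : `[< exists2 i', f i' = f i & e i' >] = e i.
  by apply/asboolP/idP => [[i' /finj ->]//|ei]; exists i.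
apply/seteqP; split=> z.
  by move=> zF _ /imfsetP[i /= iF ->]; rewrite zF// eE.
by move=> zF i iF; rewrite zF ?eE//; apply: in_imfset.
Qed.

Lemma fair_reindex_law (I I' : choiceType) (f : I' -> I)
    (nu : probability (seq_space I bool) R) :
  injective f -> fair nu -> fair (image_law nu (measurable_reindex f)).
Proof. by move=> finj fnu F e; rewrite image_lawE; exact: fair_reindex. Qed.

End fair_bits.

(** * Binary digits of the points of the unit interval *)

Section binary_digits.
Context {R : realType}.
Implicit Types (x y s : R).

(** Iterating the doubling map shifts the binary expansion, so every digit is the
leading digit of an iterate. *)
Definition doubling x : R := if 2^-1 <= x then 2 * x - 1 else 2 * x.

Definition digit (n : nat) x : bool := 2^-1 <= iter n doubling x.

Definition dyadic (n : nat) (z : nat -> bool) : R :=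
  \sum_(k < n) (2^-1) ^+ k.+1 *+ z k.

Lemma dyadic_digits n x : x = dyadic n (digit ^~ x) + (2^-1) ^+ n * iter n doubling x.
Proof.
elim: n => [|n IH]; first by rewrite /dyadic big_ord0 add0r expr0 mul1r.
rewrite {1}IH /dyadic big_ord_recr /= -/(dyadic _ _) -addrA; congr (_ + _).
rewrite /digit /doubling; set y := iter n _ _.
by case: ifP => _; rewrite ?mulr1n ?mulr0n exprSr; lra.
Qed.

Lemma doubling_itv n x : 0 <= x < 1 -> 0 <= iter n doubling x < 1.
Proof.
move=> x01; elim: n => //= n; rewrite /doubling; set y := iter n _ _.
by move=> /andP[y0 y1]; case: ifPn; rewrite -?ltNge => ?; apply/andP; split; lra.
Qed.

Lemma measurable_doubling n : measurable_fun setT (iter n doubling : R -> R).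
Proof.
elim: n => [|n IH]; first exact: measurable_id.
rewrite /=; apply: measurable_fun_ifT => /=.
- exact: measurable_fun_ler.
- by apply: measurable_funB => //; apply: measurable_funM.
- by apply: measurable_funM.
Qed.

Lemma measurable_digit n (b : bool) : measurable [set x : R | digit n x = b].
Proof.
have mD : measurable_fun setT (digit n : R -> bool).
  by apply: measurable_fun_ler => //; exact: measurable_doubling.
by have := mD measurableT [set b] I; rewrite setTI.
Qed.

(** The interval splits into its halves according to its next digit, and on each
half the next iterate is again affine.  A prescribed digit keeps one half, a free
one keeps both. *)
Lemma lebesgue_digits (F : {fset nat}) (e : nat -> bool) m n s :
  (forall x, s <= x < s + (2^-1) ^+ n -> iter n doubling x = 2 ^+ n * (x - s)) ->
  lebesgue_measure (`[s, s + (2^-1) ^+ n[%classic `&`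
      [set x | forall i, (i < m)%N -> n + i \in F -> digit (n + i) x = e (n + i)]%N)
  = ((2^-1) ^+ n * \prod_(i < m) (if (n + i)%N \in F then 2^-1 else 1))%:E.
Proof.
elim: m n s => [|m IH] n s Hs.
  rewrite big_ord0 mulr1 [X in _ `&` X](_ : _ = setT) ?setIT; last first.
    by rewrite -subTset => x _ i.
  rewrite lebesgue_measure_itv /= lte_fin ltrDl exprn_gt0 ?invr_gt0 ?ltr0n//.
  by rewrite -EFinD addrAC subrr add0r.
pose s' (b : bool) := s + (2^-1) ^+ n.+1 *+ b.
pose X b := `[s' b, s' b + (2^-1) ^+ n.+1[%classic `&`
   [set x | forall i, (i < m)%N -> n.+1 + i \in F -> digit (n.+1 + i) x = e (n.+1 + i)]%N.
have p0 : 0 < (2^-1 : R) ^+ n by rewrite exprn_gt0 ?invr_gt0.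
have pS : (2^-1 : R) ^+ n = (2^-1) ^+ n.+1 + (2^-1) ^+ n.+1 by rewrite exprSr; lra.
have p1 : 0 < (2^-1 : R) ^+ n.+1 by rewrite exprn_gt0 ?invr_gt0.
have pK : 2 ^+ n * (2^-1 : R) ^+ n = 1 by rewrite -exprMn divff ?expr1n.
have sub b x : s' b <= x < s' b + (2^-1) ^+ n.+1 -> s <= x < s + (2^-1) ^+ n.
  by rewrite /s'; case: b; rewrite ?mulr1n ?mulr0n => /andP[? ?]; apply/andP; split; lra.
have dig b x : s' b <= x < s' b + (2^-1) ^+ n.+1 -> digit n x = b.
  move=> xb; rewrite /digit (Hs _ (sub _ _ xb)).
  move: xb; rewrite /s' => /andP[].
  have e2 : 2^-1 = 2 ^+ n * (2^-1 : R) ^+ n.+1 by rewrite exprSr mulrA pK mul1r.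
  have -> : (2^-1 <= 2 ^+ n * (x - s)) = ((2^-1) ^+ n.+1 <= x - s).
    by rewrite {1}e2 ler_pM2l// exprn_gt0.
  case: b; rewrite ?mulr1n ?mulr0n => ? ?.
    by apply/idP; lra.
  by apply/negbTE; rewrite -ltNge; lra.
have mX b : lebesgue_measure (X b) =
    ((2^-1) ^+ n.+1 * \prod_(i < m) (if (n.+1 + i)%N \in F then 2^-1 else 1))%:E.
  apply: IH => x xb; rewrite /= /doubling (Hs _ (sub _ _ xb)).
  rewrite -[_ <= _](_ : digit n x = _); last by rewrite /digit (Hs _ (sub _ _ xb)).
  rewrite (dig _ _ xb) /s' (exprSr 2); case: b {xb}; rewrite ?mulr1n ?mulr0n; last by ring.
  have q1 : 2 * (2 ^+ n * (2^-1 : R) ^+ n.+1) = 1.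
    by rewrite exprSr (mulrA (2 ^+ n)) pK; lra.
  by rewrite -[X in _ - X]q1; ring.
have mbX b : measurable (X b).
  apply: measurableI => //.
  rewrite (_ : mkset _ = \bigcap_(i in [set i | (i < m)%N /\ (n.+1 + i)%N \in F])
      [set x | digit (n.+1 + i)%N x = e (n.+1 + i)%N]).
    by apply: bigcap_measurableType => i _; exact: measurable_digit.
  apply/seteqP; split=> x /= h i; first by case=> ? ?; exact: h.
  by move=> im iF; exact: h.
have XE : `[s, s + (2^-1) ^+ n[%classic `&`
      [set x | forall i, (i < m.+1)%N -> n + i \in F -> digit (n + i) x = e (n + i)]%N
   = \bigcup_(b in [set b | n \in F -> b = e n]) X b.
  apply/seteqP; split=> [x []|x [b /= bF [/= xb h]]].
    rewrite /= in_itv /= => xs h.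
    have xb : s' (digit n x) <= x < s' (digit n x) + (2^-1) ^+ n.+1.
      have [//|xlt] := boolP (s' (digit n x) <= x < s' (digit n x) + (2^-1) ^+ n.+1).
      suff : s' (~~ digit n x) <= x < s' (~~ digit n x) + (2^-1) ^+ n.+1.
        by move=> /dig; case: digit.
      move: xlt xs; rewrite negb_and -ltNge -leNgt /s' => /orP.
      by case: digit; rewrite ?mulr1n ?mulr0n => -[] ? /andP[? ?];
         apply/andP; split; lra.
    exists (digit n x) => /=.
      by move=> nF; have := h 0%N isT; rewrite addn0; exact.
    split; first by rewrite /= in_itv.
    by move=> i im; have := h i.+1 im; rewrite -addSnnS.
  move: xb; rewrite in_itv /= => xb; split; first by rewrite /= in_itv /=; exact: sub xb.
  move=> [|i] im; first by rewrite addn0 (dig _ _ xb) => /bF.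
  by rewrite addnS -addSn => iF; exact: h.
rewrite XE big_ord_recl /= addn0.
under eq_bigr do rewrite /bump /= addnA addn1.
set w := \prod_(i < m) _ in mX *.
have [nF|nF] := boolP (n \in F).
  rewrite (_ : \bigcup_(b in _) _ = X (e n)); last first.
    by apply/seteqP; split=> [x [b /= -> //]|x xb]; exists (e n).
  by rewrite mX exprSr mulrA.
rewrite (_ : \bigcup_(b in _) _ = X true `|` X false); last first.
  apply/seteqP; split=> [x [[] _ xb]|x [] xb]; [by left|by right| |].
    by exists true => //= h; rewrite h in nF.
  by exists false => //= h; rewrite h in nF.
transitivity (lebesgue_measure (X true) + lebesgue_measure (X false))%E.
  apply: measureU; [exact: mbX|exact: mbX|].
  apply/seteqP; split=> // x [[/= + _] [/= + _]].
  by rewrite !in_itv /= => /dig d1 /dig; rewrite d1.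
by rewrite !mX -EFinD; congr EFin; rewrite mul1r pS mulrDl.
Qed.

End binary_digits.

(** * Existence of fair coins and uniformity of their binary value *)

Section fair_existence.
Context {R : realType}.

Definition unit_lebesgue : set (measurableTypeR R) -> \bar R :=
  mrestr lebesgue_measure (measurable_itv `[(0:R), 1[).

HB.instance Definition _ := Measure.on unit_lebesgue.

Lemma unit_lebesgueT : unit_lebesgue setT = 1%E.
Proof.
rewrite /unit_lebesgue /mrestr /= setTI lebesgue_measure_itv /= lte_fin ltr01.
by rewrite oppr0 adde0.
Qed.

HB.instance Definition _ := @Measure_isProbability.Build _ _ R unit_lebesgue
  unit_lebesgueT.

Definition digits (x : measurableTypeR R) : seq_space nat bool := digit ^~ x.

Lemma measurable_digits : measurable_fun setT digits.
Proof.
apply: measurable_seq_space; first exact: countableP.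
by move=> n b; exact: measurable_digit.
Qed.

Definition coin_seq : probability (seq_space nat bool) R :=
  image_law unit_lebesgue measurable_digits.

Lemma fair_coin_seq : fair coin_seq.
Proof.
move=> F e; rewrite image_lawE.
pose m := (\max_(i <- enum_fset F) i).+1.
have Fm i : i \in F -> (i < m)%N by move=> iF; rewrite ltnS; apply: leq_bigmax_seq.
have := @lebesgue_digits R F e m 0 0.
rewrite expr0 add0r mul1r => L.
transitivity (\prod_(i < m) (if (0 + i)%N \in F then 2^-1 else 1) : R)%:E; last first.
  congr EFin.
  rewrite -(big_mkord xpredT (fun i => if (0 + i)%N \in F then 2^-1 else 1 : R)).
  rewrite -big_mkcond /= -big_filter big_const_seq count_predT iter_mulr_1.
  congr (_ ^+ _); apply/perm_size/uniq_perm; rewrite ?filter_uniq ?iota_uniq ?fset_uniq//.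
  move=> i; rewrite mem_filter mem_index_iota add0n /=.
  by case: (boolP (i \in _)) => // /Fm.
rewrite -L; last by move=> x _; rewrite subr0 mul1r.
rewrite /unit_lebesgue /mrestr /=; congr (lebesgue_measure _).
rewrite setIC; apply/seteqP; split=> x [x01 xF]; split=> // i.
  by move=> im iF; exact: (xF i iF).
by move=> iF; exact: (xF i (Fm _ iF) iF).
Qed.

End fair_existence.

Section uniform_bits.
Context {R : realType}.
Implicit Types z : nat -> bool.

Definition fair_coins (I : countType) : probability (seq_space I bool) R :=
  image_law coin_seq (measurable_reindex (@choice.pickle I)).

Lemma fair_fair_coins (I : countType) : fair (fair_coins I).
Proof.
by apply: fair_reindex_law; [exact: pcan_inj (@choice.pickleK I)|exact: fair_coin_seq].
Qed.

Lemma eq_dyadic n z z' : (forall k, (k < n)%N -> z k = z' k) ->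
  dyadic n z = dyadic n z' :> R.
Proof. by move=> zz'; apply: eq_bigr => k _; rewrite zz'. Qed.

Lemma measurable_prefix n (Q : R -> Prop) :
  measurable [set z : seq_space nat bool | Q (dyadic n z)].
Proof.
apply: (@finite_coords_measurable nat bool (iota 0 n)); first exact: countableP.
move=> u v /eq_in_map uv /=; rewrite (@eq_dyadic n u v)// => k kn.
by apply: uv; rewrite mem_iota.
Qed.

Lemma ler_dyadic n z z' : (forall k, z k ==> z' k) -> dyadic n z <= dyadic n z' :> R.
Proof.
move=> zz'; apply: ler_sum => k _; have := zz' k.
by case: (z k); case: (z' k) => // _; rewrite mulr1n mulr0n exprn_ge0// invr_ge0.
Qed.

Lemma dyadic_tail n k z :
  dyadic (n + k) z + (2^-1) ^+ (n + k) <= dyadic n z + (2^-1) ^+ n :> R.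
Proof.
elim: k => [|k IH]; first by rewrite addn0.
apply: le_trans IH; rewrite addnS /dyadic big_ord_recr /=.
have : 0 <= (2^-1 : R) ^+ (n + k) by rewrite exprn_ge0// invr_ge0.
by rewrite exprSr; case: (z _) => ?; rewrite ?mulr1n ?mulr0n; lra.
Qed.

Lemma dyadic_mono n k z : dyadic n z <= dyadic (n + k) z :> R.
Proof.
elim: k => [|k IH]; first by rewrite addn0.
apply: le_trans IH _; rewrite addnS /dyadic big_ord_recr /= lerDl.
by apply: mulrn_wge0; rewrite exprn_ge0// invr_ge0.
Qed.

(** The partial sums and the partial sums rounded up enclose the binary value
from both sides. *)
Lemma dyadic_lower_upper n n' z : dyadic n z <= dyadic n' z + (2^-1) ^+ n' :> R.
Proof.
apply: (le_trans (dyadic_mono n n' z)).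
rewrite addnC; apply: le_trans (dyadic_tail n' n z).
by rewrite lerDl exprn_ge0// invr_ge0.
Qed.

Lemma halves_lt (a b : R) : a < b -> exists n, (2^-1) ^+ n < b - a.
Proof.
move=> ab; have c : (2^-1 : R) ^+ n @[n --> \oo] --> (0 : R).
  by apply: cvg_expr; rewrite ger0_norm ?invr_ge0// invf_lt1// ltr1n.
have : \forall n \near \oo, (2^-1 : R) ^+ n < b - a.
  by apply: (cvgr_lt 0 c); rewrite subr_gt0.
by case=> N _ /(_ N (leqnn N)) hN; exists N.
Qed.

Lemma digits_lower n (x : R) : 0 <= x < 1 -> dyadic n (digit ^~ x) <= x.
Proof.
move=> x01; rewrite [leRHS](dyadic_digits n x) lerDl.
by rewrite mulr_ge0 ?exprn_ge0 ?invr_ge0//; have /andP[] := doubling_itv n x01.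
Qed.

Lemma digits_upper n (x : R) :
  0 <= x < 1 -> x < dyadic n (digit ^~ x) + (2^-1) ^+ n.
Proof.
move=> x01; rewrite {1}(dyadic_digits n x) ltrD2l.
have /andP[_ ?] := doubling_itv n x01.
by rewrite -[ltRHS]mulr1 ltr_pM2l ?exprn_gt0 ?invr_gt0.
Qed.

(** The binary value is uniform, and it is at most g exactly when all its partial
sums are.  Speaking of partial sums only, this event is also meaningful when
finitely many digits are known. *)
Lemma fair_dyadic_le (nu : probability (seq_space nat bool) R) (g : R) :
  fair nu -> 0 <= g <= 1 -> nu [set z | forall n, dyadic n z <= g] = g%:E.
Proof.
move=> fnu /andP[g0 g1].
rewrite (fair_unique fnu fair_coin_seq); last first.
  rewrite (_ : mkset _ = \bigcap_n [set z | dyadic n z <= g]).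
    by apply: bigcap_measurableType => n _; exact: (measurable_prefix n (fun x => x <= g)).
  by apply/seteqP; split=> z h n; [move=> _; exact: h|exact: (h n I)].
rewrite image_lawE /= /unit_lebesgue /mrestr /=.
rewrite (_ : _ `&` _ = [set x : R | 0 <= x < 1 /\ x <= g]); last first.
  apply/seteqP; split=> x /=; rewrite !in_itv /=.
    move=> [xg x01]; split=> //; rewrite leNgt; apply/negP => gx.
    have [n hn] := halves_lt gx.
    have := digits_upper n x01; have := xg n; lra.
  move=> [x01 xg]; split=> // n; exact: le_trans (digits_lower n x01) xg.
have [g_lt1|g_ge1] := ltP g 1.
  rewrite (_ : mkset _ = `[0, g]%classic).
    by rewrite lebesgue_measure_itv /= lte_fin; case: ltgtP g0 => // [|<-//] _;
      rewrite oppr0 adde0.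
  apply/seteqP; split=> x /=; rewrite in_itv /=; first by move=> [/andP[-> _] ->].
  by move=> /andP[-> xg]; split=> //=; exact: le_lt_trans xg _.
have -> : g = 1 by apply/le_anti; rewrite g1.
rewrite (_ : mkset _ = `[0, 1[%classic).
  by rewrite lebesgue_measure_itv /= lte_fin ltr01 oppr0 adde0.
apply/seteqP; split=> x /=; rewrite in_itv /=; first by case.
by move=> x01; split=> //; have /andP[_ /ltW] := x01.
Qed.

(** Dually, the binary value is less than g exactly when some partial sum rounded
up is. *)
Lemma fair_dyadic_lt (nu : probability (seq_space nat bool) R) (g : R) :
  fair nu -> 0 <= g <= 1 ->
  nu [set z | exists n, dyadic n z + (2^-1) ^+ n < g] = g%:E.
Proof.
move=> fnu /andP[g0 g1].
rewrite (fair_unique fnu fair_coin_seq); last first.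
  rewrite (_ : mkset _ = \bigcup_n [set z | dyadic n z + (2^-1) ^+ n < g]).
    apply: bigcup_measurable => n _.
    exact: (measurable_prefix n (fun x => x + (2^-1) ^+ n < g)).
  by apply/seteqP; split=> z [n]; [exists n|move=> _ h; exists n].
rewrite image_lawE /= /unit_lebesgue /mrestr /=.
have -> : (g%:E = lebesgue_measure (`[0%R, g[%classic : set R))%E.
  rewrite lebesgue_measure_itv /= lte_fin; case: ltgtP g0 => // [|<-//] _.
  by rewrite oppr0 adde0.
congr (lebesgue_measure _); apply/seteqP; split=> x /=; rewrite !in_itv /=.
  move=> [[n xn] x01]; have /andP[-> _]/= := x01.
  exact: lt_trans (digits_upper n x01) xn.
move=> /andP[x0 xg]; have x01 : 0 <= x < 1 by rewrite x0 (lt_le_trans xg).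
split=> //; have [n hn] := halves_lt xg.
exists n; have := digits_lower n x01; rewrite /digits; lra.
Qed.

End uniform_bits.

(** * Attractive kernels and their tails *)

Section attractive_kernels.
Context {R : realType} {m : nat}.
Implicit Types (P : alphabet m -> pasts m -> R) (x y : pasts m) (a b : alphabet m)
  (z : nat -> bool).

Lemma near_prefix (T : Type) (xs : nat -> nat -> T) (x : nat -> T) k :
  (forall j, \forall n \near \oo, xs n j = x j) ->
  \forall n \near \oo, forall j, (j < k)%N -> xs n j = x j.
Proof.
move=> cv; elim: k => [|k IH]; first exact: nearW.
near=> n => j; rewrite ltnS leq_eqVlt => /orP[/eqP ->|].
  by near: n; exact: cv.
by move: j; near: n.
Unshelve. all: by end_near. Qed.

Lemma continuous_kernel_prefix P : is_kernel P -> continuous_kernel P ->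
  forall eps : R, 0 < eps -> exists k, forall b x y,
    (forall j, (j < k)%N -> x j = y j) -> `|P b x - P b y| < eps.
Proof.
move=> [P01 _] Pc eps e0.
have : \forall k \near \oo, kernel_var P k < eps by apply: (cvgr_lt 0 Pc).
case=> k _ /(_ k (leqnn k)) /= hk; exists k => b x y xy.
apply: le_lt_trans hk.
have cat (w : pasts m) : cat_past [tuple w i | i < k] (fun n => w (n + k)%N) = w.
  apply/funext => n; rewrite /cat_past.
  have [nk|kn] := ltnP n k.
    by rewrite (nth_map (Ordinal nk)) ?size_enum_ord// nth_enum_ord.
  by rewrite nth_default ?size_tuple// subnK.
apply: sup_ubound.
  exists 1 => _ [b' [t [x' [y' ->]]]].
  have /andP[? ?] := P01 b' (cat_past t x').
  have /andP[? ?] := P01 b' (cat_past t y').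
  by rewrite ler_norml; apply/andP; split; lra.
exists b, [tuple x i | i < k], (fun n => x (n + k)%N), (fun n => y (n + k)%N).
rewrite cat (_ : [tuple x i | i < k] = [tuple y i | i < k]) ?cat//.
by apply: eq_from_tnth => i; rewrite !tnth_mktuple xy.
Qed.

Lemma kernel_cvg P (xs : nat -> pasts m) x b :
  is_kernel P -> continuous_kernel P ->
  (forall j, \forall n \near \oo, xs n j = x j) ->
  P b (xs n) @[n --> \oo] --> P b x.
Proof.
move=> Pk Pc cv; apply/cvgrPdist_lt => e e0.
have [k hk] := continuous_kernel_prefix Pk Pc e0.
near=> n; apply: hk => j jk; apply/esym; move: j jk.
by near: n; exact: near_prefix.
Unshelve. all: by end_near. Qed.

(** A continuous kernel is a limit of functions of finitely many past letters. *)
Lemma measurable_kernel P a : is_kernel P -> continuous_kernel P ->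
  measurable_fun setT (P a).
Proof.
move=> Pk Pc.
pose cut n x : pasts m := fun j => if (j < n)%N then x j else ord0.
apply: (@measurable_fun_cvg _ _ _ setT (fun n x => P a (cut n x))) => [n|x _].
  move=> _ B _; rewrite setTI.
  apply: (@finite_coords_measurable nat (alphabet m) (iota 0 n)).
    exact: countableP.
  move=> u v /eq_in_map uv; rewrite /preimage /= (_ : cut n u = cut n v)//.
  by apply/funext => j; rewrite /cut; case: ifP => // jn; apply: uv; rewrite mem_iota.
apply: kernel_cvg => // j; exists j.+1 => // n /= jn.
by rewrite /cut jn.
Qed.

Definition tail P a x : R := \sum_(j : alphabet m | (a <= j)%N) P j x.

Lemma tail0 P x : is_kernel P -> tail P ord0 x = 1.
Proof. by move=> [_ P1]; rewrite -(P1 x); apply: eq_bigl. Qed.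

Lemma ler_tail P a b x : is_kernel P -> (a <= b)%N -> tail P b x <= tail P a x.
Proof.
move=> [P01 _] ab; rewrite /tail [leRHS](bigID (fun j : alphabet m => (b <= j)%N)) /=.
rewrite [X in _ <= X + _](eq_bigl (fun j : alphabet m => (b <= j)%N)); last first.
  by move=> j; rewrite andbC; case: (leqP b j) => // /(leq_trans ab) ->.
by rewrite lerDl sumr_ge0// => j _; have /andP[] := P01 j x.
Qed.

Lemma tail01 P a x : is_kernel P -> 0 <= tail P a x <= 1.
Proof.
move=> Pk; rewrite -(tail0 x Pk) ler_tail// andbT sumr_ge0// => j _.
by have /andP[] := Pk.1 j x.
Qed.

Lemma tailS P a b x : b = a.+1 :> nat -> tail P a x = P a x + tail P b x.
Proof.
move=> ba; rewrite /tail (bigD1 a)//=; congr (_ + _); apply: eq_bigl => j.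
by rewrite ba ltn_neqAle eq_sym andbC.
Qed.

Lemma tail_max P a x : a = m :> nat -> tail P a x = P a x.
Proof.
move=> am; rewrite /tail (big_pred1 a)// => j; rewrite am /= -val_eqE /= am.
by rewrite eqn_leq -[(j <= m)%N]ltnS ltn_ord.
Qed.

Lemma tail_cvg P (xs : nat -> pasts m) x a :
  is_kernel P -> continuous_kernel P ->
  (forall j, \forall n \near \oo, xs n j = x j) ->
  tail P a (xs n) @[n --> \oo] --> tail P a x.
Proof.
move=> Pk Pc cv; rewrite /tail; elim: (index_enum _) => [|j s IH].
  by under eq_fun do rewrite big_nil; rewrite big_nil; exact: cvg_cst.
under eq_fun do rewrite big_cons; rewrite big_cons; case: ifP => // _.
by apply: cvgD => //; exact: kernel_cvg.
Qed.

Lemma measurable_tail P a : is_kernel P -> continuous_kernel P ->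
  measurable_fun setT (tail P a).
Proof.
move=> Pk Pc.
rewrite (_ : tail P a = fun x =>
  \sum_(j <- [seq j : alphabet m <- index_enum (alphabet m) | (a <= j)%N]) P j x).
  by apply: measurable_sum => j; exact: measurable_kernel.
by apply/funext => x; rewrite big_filter.
Qed.

Definition level (c : alphabet m -> Prop) : alphabet m :=
  arg_max ord0 (fun a => `[< c a >]) (fun a => nat_of_ord a).

Lemma levelP (c : alphabet m -> Prop) a : c ord0 ->
  (forall a b, (a <= b)%N -> c b -> c a) -> (a <= level c)%N <-> c a.
Proof.
move=> c0 cdown; rewrite /level; case: arg_maxnP => [|b /asboolP cb bmax].
  exact/asboolP.
by split=> [ab|/asboolP/bmax]//; exact: cdown cb.
Qed.

(** The quantile rule with a non-strict threshold.  Its condition persists when the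
digits increase to a limit and the past decreases to a limit, as happens for the
upper chain. *)
Definition up_update P z x : alphabet m :=
  level (fun a => forall n, dyadic n z <= tail P a x).

(** The quantile rule with a strict threshold, whose failure persists in the limits
met by the lower chain.  The bottom letter is always allowed, because the
condition fails for it when all digits are 1. *)
Definition low_update P z x : alphabet m :=
  level (fun a => a = ord0 \/ exists n, dyadic n z + (2^-1) ^+ n < tail P a x).

Lemma dyadic_le1 n z : dyadic n z <= 1 :> R.
Proof.
have := @dyadic_lower_upper R n 0 z.
by rewrite [dyadic 0 z]big_ord0 add0r expr0.
Qed.

Lemma up_updateP P z x a : is_kernel P ->
  (a <= up_update P z x)%N <-> forall n, dyadic n z <= tail P a x.
Proof.
move=> Pk; apply: levelP => [n|b c bc h n]; first by rewrite tail0// dyadic_le1.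
exact: le_trans (h n) (ler_tail _ _ _).
Qed.

Lemma low_updateP P z x a : is_kernel P ->
  (a <= low_update P z x)%N <->
  a = ord0 \/ exists n, dyadic n z + (2^-1) ^+ n < tail P a x.
Proof.
move=> Pk; apply: levelP => [|b c bc [c0|[n hn]]]; first by left.
  by left; apply/val_inj => /=; move: bc; rewrite c0 leqn0 => /eqP.
by right; exists n; apply: (lt_le_trans hn); exact: ler_tail.
Qed.

Lemma ler_tail_attractive P a x y : attractive P -> (forall j, (x j <= y j)%N) ->
  tail P a x <= tail P a y.
Proof. by move=> Pa xy; exact: Pa. Qed.

End attractive_kernels.

(** * Monotone updates *)

Section updates.
Context {R : realType} {m : nat}.
Implicit Types (x y : pasts m) (a b : alphabet m) (z : nat -> bool)
  (F : (nat -> bool) -> pasts m -> alphabet m).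

(** Continuity is required only along sequences that converge from the side from
which the chain approaches its limit: a quantile rule jumps at its thresholds, and
is continuous from one side only. *)
Record monotone_update (h : alphabet m -> nat) (r : rel bool) F : Prop :=
  MonotoneUpdate {
    update_mono : forall z z' x x', (forall k, r (z k) (z' k)) ->
      (forall j, (h (x j) <= h (x' j))%N) -> (h (F z' x) <= h (F z x'))%N ;
    update_cont : forall (zs : nat -> nat -> bool) z (xs : nat -> pasts m) x,
      (forall n k, r (zs n k) (z k)) -> (forall n j, (h (x j) <= h (xs n j))%N) ->
      (forall k, \forall n \near \oo, zs n k = z k) ->
      (forall j, \forall n \near \oo, xs n j = x j) ->
      \forall n \near \oo, F (zs n) (xs n) = F z x }.

Record simulates (P : alphabet m -> pasts m -> R) F : Prop := Simulates {
  update_measurable : forall a,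
    measurable [set xz : pasts m * seq_space nat bool | F xz.2 xz.1 = a] ;
  update_law : forall (nu : probability (seq_space nat bool) R) x a, fair nu ->
    nu [set z | F z x = a] = (P a x)%:E }.

(** The event that the update equals a is the difference of two consecutive tail
events, or a tail event if a is the top letter. *)
Lemma simulates_tail (P : alphabet m -> pasts m -> R) F :
  is_kernel P ->
  (forall a, measurable
    [set xz : pasts m * seq_space nat bool | (a <= F xz.2 xz.1)%N]) ->
  (forall (nu : probability (seq_space nat bool) R) x a, fair nu ->
    nu [set z | (a <= F z x)%N] = (tail P a x)%:E) ->
  simulates P F.
Proof.
move=> Pk mF nuF.
have mFx x a : measurable [set z : seq_space nat bool | (a <= F z x)%N].
  have := measurable_xsection x (mF a); congr (measurable _).
  by apply/seteqP; split=> z; rewrite /xsection /= inE.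
have split_eq a b : b = a.+1 :> nat -> forall c : alphabet m,
    c = a <-> (a <= c)%N /\ ~ (b <= c)%N.
  move=> ba c; rewrite ba; split=> [->|[ac /negP]]; first by rewrite ltnn.
  by rewrite -leqNgt => ca; apply/val_inj/eqP; rewrite /= eqn_leq ca.
have max_eq a (c : alphabet m) : a = m :> nat -> c = a <-> (a <= c)%N.
  move=> am; split=> [->//|]; rewrite am => mc; apply/val_inj/eqP.
  by rewrite /= am eqn_leq mc -ltnS ltn_ord.
have succ a : a = m :> nat \/ exists b : alphabet m, b = a.+1 :> nat.
  have [am|am] := eqVneq (a : nat) m; [by left|right].
  have lt : (a.+1 < m.+1)%N by rewrite ltnS ltn_neqAle am -ltnS ltn_ord.
  by exists (Ordinal lt).
split=> [a|nu x a fnu].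
  have [am|[b ba]] := succ a.
    have := mF a; congr (measurable _).
    by apply/seteqP; split=> xz; rewrite /mkset (max_eq _ _ am).
  have := measurableD (mF a) (mF b); congr (measurable _).
  by apply/seteqP; split=> xz /=; rewrite (split_eq _ _ ba).
have [am|[b ba]] := succ a.
  rewrite -(tail_max _ _ am) -(nuF nu)//; congr (nu _).
  by apply/seteqP; split=> xz; rewrite /mkset (max_eq _ _ am).
rewrite (_ : mkset _ = [set z | (a <= F z x)%N] `\` [set z | (b <= F z x)%N]).
  rewrite measureD ?(mFx x a) ?(mFx x b)//; last by rewrite ltey_eq fin_num_measure.
  rewrite (setIidr _).
    by rewrite /= !nuF// (tailS _ _ ba) -EFinD addrK.
  by move=> z /=; apply: leq_trans; rewrite ba.
by apply/seteqP; split=> z /=; rewrite (split_eq _ _ ba).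
Qed.

Variable P : alphabet m -> pasts m -> R.
Hypotheses (Pk : is_kernel P) (Pa : attractive P) (Pc : continuous_kernel P).

Lemma measurable_joint (Q : R -> R -> Prop) n a :
  (forall f g : pasts m * seq_space nat bool -> R,
     measurable_fun setT f -> measurable_fun setT g ->
     measurable [set w | Q (f w) (g w)]) ->
  measurable [set xz : pasts m * seq_space nat bool |
    Q (dyadic n xz.2) (tail P a xz.1)].
Proof.
move=> mQ; apply: mQ.
  apply: (measurableT_comp (f := dyadic n : seq_space nat bool -> R)) => //.
  by move=> _ B _; rewrite setTI; exact: (measurable_prefix n B).
by apply: (measurableT_comp (f := tail P a)) => //; exact: measurable_tail.
Qed.

Lemma up_update_simulates : simulates P (up_update P).
Proof.
apply: simulates_tail => // [a|nu x a fnu].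
  rewrite (_ : mkset _ = \bigcap_n [set xz | dyadic n xz.2 <= tail P a xz.1]).
    apply: bigcap_measurableType => n _.
    apply: (measurable_joint (Q := fun s t => s <= t)) => f g mf mg.
    by have := measurable_fun_le measurableT mf mg; rewrite setTI.
  apply/seteqP; split=> xz /=; rewrite up_updateP// => h n.
    by move=> _; exact: h.
  exact: (h n I).
rewrite -(fair_dyadic_le fnu (tail01 a x Pk)); congr (nu _).
by apply/seteqP; split=> z /=; rewrite up_updateP.
Qed.

Lemma low_update_simulates : simulates P (low_update P).
Proof.
apply: simulates_tail => // [a|nu x a fnu].
  have [->|a0] := eqVneq a ord0; first by
    rewrite (_ : mkset _ = setT)//; apply/seteqP; split.
  rewrite (_ : mkset _ = \bigcup_n [set xz | dyadic n xz.2 + (2^-1) ^+ n < tail P a xz.1]).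
    apply: bigcup_measurable => n _.
    apply: (measurable_joint (Q := fun s t => s + (2^-1) ^+ n < t)) => f g mf mg.
    have := measurable_fun_ltr (measurable_funD mf (measurable_cst ((2^-1 : R) ^+ n))) mg.
    by move=> /(_ measurableT [set true] I); rewrite setTI.
  apply/seteqP; split=> xz /=; rewrite low_updateP//.
    by move=> [/eqP|[n hn]]; [rewrite (negbTE a0)|exists n].
  by move=> [n _ hn]; right; exists n.
have [->|a0] := eqVneq a ord0.
  by rewrite tail0// (_ : mkset _ = setT) ?probability_setT//; apply/seteqP; split.
rewrite -(fair_dyadic_lt fnu (tail01 a x Pk)); congr (nu _).
apply/seteqP; split=> z /=; rewrite low_updateP//; last by right.
by case=> // /eqP; rewrite (negbTE a0).
Qed.

(** Monotonicity gives one inequality in the limit.  For the other, the letter above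
the limit value is excluded by a single partial sum that exceeds the tail by a
margin, and this exclusion persists nearby. *)
Lemma up_update_monotone :
  monotone_update (fun a => a : nat) implb (up_update P).
Proof.
have mono z z' x x' : (forall k, z k ==> z' k) -> (forall j, (x j <= x' j)%N) ->
    (up_update P z' x <= up_update P z x')%N.
  move=> zz' xx'; apply/up_updateP => // n.
  have /(up_updateP _ _ _ Pk) h := leqnn (up_update P z' x).
  apply: le_trans (ler_dyadic n zz') _; apply: le_trans (h n) _.
  exact: ler_tail_attractive.
split=> // zs z xs x zsz xxs zcv xcv.
set v := up_update P z x.
have vF n : (v <= up_update P (zs n) (xs n))%N by exact: mono.
have [vm|vm] := eqVneq (v : nat) m.
  apply: nearW => n; apply/val_inj/eqP; rewrite /= eqn_leq vF andbT vm.
  by rewrite -ltnS ltn_ord.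
have lt : (v.+1 < m.+1)%N by rewrite ltnS ltn_neqAle vm -ltnS ltn_ord.
pose a : alphabet m := Ordinal lt.
have /existsNP[i /negP] : ~ (forall n, dyadic n z <= tail P a x).
  by move=> /(up_updateP _ _ _ Pk); rewrite /= ltnn.
rewrite -ltNge => hi.
near=> n; apply/val_inj/eqP; rewrite /= eqn_leq vF andbT -ltnS ltnNge.
apply/negP => /(up_updateP _ _ a Pk)/(_ i).
apply/negP; rewrite -ltNge.
rewrite (@eq_dyadic R i (zs n) z); first by
  near: n; exact: (cvgr_lt _ (tail_cvg Pk Pc xcv)).
by near: n; exact: near_prefix.
Unshelve. all: by end_near. Qed.

(** Here the limit value itself is certified by one rounded partial sum with a margin
below the tail, and the certificate persists nearby. *)
Lemma low_update_monotone :
  monotone_update (fun a => m - a)%N (fun c c' => c' ==> c) (low_update P).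
Proof.
have rev_le a b : (m - a <= m - b)%N = (b <= a)%N.
  by rewrite leq_sub2lE// -ltnS ltn_ord.
have mono z z' x x' : (forall k, z' k ==> z k) -> (forall j, (x' j <= x j)%N) ->
    (low_update P z x' <= low_update P z' x)%N.
  move=> zz' xx'; apply/low_updateP => //.
  have /(low_updateP _ _ _ Pk)[|[n hn]] := leqnn (low_update P z x'); first by left.
  right; exists n; apply: (@le_lt_trans _ _ (dyadic n z + (2^-1) ^+ n)).
    by rewrite lerD2r; exact: ler_dyadic.
  by apply: lt_le_trans hn _; exact: ler_tail_attractive.
split=> [z z' x x' zz' xx'|zs z xs x zsz xxs zcv xcv].
  by rewrite rev_le; apply: mono => // j; rewrite -rev_le.
set v := low_update P z x.
have Fv n : (low_update P (zs n) (xs n) <= v)%N.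
  by apply: mono => // j; rewrite -rev_le.
have /(low_updateP _ _ _ Pk)[v0|[i hi]] := leqnn v.
  apply: nearW => n; apply/val_inj/eqP.
  by rewrite eqn_leq Fv; move: v0; rewrite -/v => ->.
near=> n; apply/val_inj/eqP; rewrite /= eqn_leq Fv /=.
apply/low_updateP => //; right; exists i.
rewrite (@eq_dyadic R i (zs n) z); first by
  near: n; exact: (cvgr_gt _ (tail_cvg Pk Pc xcv)).
by near: n; exact: near_prefix.
Unshelve. all: by end_near. Qed.

Lemma low_update_le_up_update z z' x x' :
  (forall k, z' k ==> z k) -> (forall j, (x j <= x' j)%N) ->
  (low_update P z x <= up_update P z' x')%N.
Proof.
move=> zz' xx'; apply/up_updateP => // n.
have /(low_updateP _ _ _ Pk)[->|[i hi]] := leqnn (low_update P z x).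
  by rewrite tail0// dyadic_le1.
apply: le_trans (ler_dyadic n zz') _.
apply: le_trans (dyadic_lower_upper n i z) _; apply: le_trans (ltW hi) _.
exact: ler_tail_attractive.
Qed.

End updates.

(** * Chains started in the past and their limits *)

Section chains.
Context {m : nat}.
Implicit Types (F : (nat -> bool) -> pasts m -> alphabet m)
  (z : int -> nat -> bool) (w : int -> alphabet m) (s t : int) (e : alphabet m).

Definition past_at w t : pasts m := fun j => w (t - j.+1%:Z).

(** The latest value comes first, as in a past; reading beyond the start returns the
letter e. *)
Fixpoint history e (f : nat -> pasts m -> alphabet m) n : seq (alphabet m) :=
  if n is n'.+1 then f n' (nth e (history e f n')) :: history e f n' else [::].

Definition chain_from e F z s t : alphabet m :=
  if t - s is Posz n then head e (history e (fun i => F (z (s + i%:Z))) n.+1)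
  else e.

Lemma size_history e f n : size (history e f n) = n.
Proof. by elim: n => //= n ->. Qed.

Lemma nth_history e f n j : (j < n)%N ->
  nth e (history e f n) j = head e (history e f (n - j)).
Proof.
elim: n j => // n IH [|j] jn; first by rewrite subn0.
by rewrite subSS -IH.
Qed.

Lemma chain_from_lt e F z s t : t < s -> chain_from e F z s t = e.
Proof. by rewrite -subr_lt0 /chain_from; case: (t - s). Qed.

Lemma chain_fromE e F z s t : s <= t ->
  chain_from e F z s t = F (z t) (past_at (chain_from e F z s) t).
Proof.
rewrite -subr_ge0 {1}/chain_from; case E: (t - s) => [n|//] _.
have tE : t = s + n%:Z by rewrite -E addrC subrK.
rewrite /= -tE; congr (F _ _); apply/funext => j; rewrite /past_at /chain_from.
have [jn|nj] := ltnP j n.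
  rewrite (_ : _ - s = (n - j.+1)%N%:Z); last by rewrite -subzn// tE; ring.
  by rewrite nth_history// subnSK.
rewrite nth_default ?size_history//.
case E' : (_ - s) => [k|//].
suff : (Posz k < 0) by [].
by rewrite -E' tE addrAC [s + _]addrC addrK subr_lt0 ltz_nat ltnS.
Qed.

Lemma chain_ind s (Q : int -> Prop) : (forall t, t < s -> Q t) ->
  (forall t, s <= t -> (forall t', t' < t -> Q t') -> Q t) -> forall t, Q t.
Proof.
move=> Qlt Qstep.
suff H n t : t < s + n%:Z -> Q t.
  move=> t; apply: (H `|t - s|.+1).
  rewrite -ltrBlDl; apply: le_lt_trans (ler_norm _) _.
  by rewrite -abszE ltz_nat.
elim: n t => [|n IH] t; first by rewrite addr0; exact: Qlt.
move=> tn; have [/Qlt//|st] := ltP t s; apply: Qstep => // t' t't; apply: IH.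
apply: lt_le_trans t't _; move: tn.
by rewrite -addn1 PoszD addrA ltzD1.
Qed.

Lemma eq_chain_from e F z z' s t :
  (forall t', s <= t' <= t -> z t' = z' t') ->
  chain_from e F z s t = chain_from e F z' s t.
Proof.
move: t; refine (@chain_ind s _ _ _) => [t ts|t st IH zz'].
  by rewrite !chain_from_lt.
rewrite !chain_fromE// zz' ?st ?lexx//; congr (F _ _); apply/funext => j.
rewrite /past_at; apply: IH; first by rewrite ltrBlDr ltrDl.
move=> t' /andP[st' t't]; apply: zz'; rewrite st' (le_trans t't)//.
by rewrite lerBlDr lerDl.
Qed.

Lemma le_chain_from (F F' : (nat -> bool) -> pasts m -> alphabet m) e e' z z' s :
  (e <= e')%N ->
  (forall t (x x' : pasts m),
    (forall j, (x j <= x' j)%N) -> (F (z t) x <= F' (z' t) x')%N) ->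
  forall t, (chain_from e F z s t <= chain_from e' F' z' s t)%N.
Proof.
move=> ee' FF'; refine (@chain_ind s _ _ _) => [t ts|t st IH].
  by rewrite !chain_from_lt.
rewrite !chain_fromE//; apply: FF' => j; apply: IH.
by rewrite ltrBlDr ltrDl.
Qed.

Definition solution F z w := forall t, w t = F (z t) (past_at w t).

Section convergence.
Variables (h : alphabet m -> nat) (r : rel bool) (e : alphabet m).
Variable F : (nat -> bool) -> pasts m -> alphabet m.
Hypotheses (h_inj : injective h) (r_refl : reflexive r).
Hypothesis e_top : forall a, (h a <= h e)%N.
Hypothesis F_mono : monotone_update h r F.

Section stages.
Variables (zs : nat -> int -> nat -> bool) (z : int -> nat -> bool).
Hypothesis zs_mono : forall n t k, r (zs n t k) (zs n.+1 t k).
Hypothesis zs_z : forall n t k, r (zs n t k) (z t k).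
Hypothesis zs_cvg : forall t k, \forall n \near \oo, zs n t k = z t k.

Local Definition stage n t := chain_from e F (zs n) (- n%:Z) t.

Lemma stage_mono n t : (h (stage n.+1 t) <= h (stage n t))%N.
Proof.
rewrite /stage; move: t; refine (@chain_ind (- n%:Z) _ _ _) => [t ts|t st IH].
  by rewrite (chain_from_lt _ _ _ ts) e_top.
have st' : - n.+1%:Z <= t by apply: le_trans st; rewrite lerN2 lez_nat.
rewrite (chain_fromE _ _ _ st) (chain_fromE _ _ _ st').
apply: (update_mono F_mono) => // j; apply: IH.
by rewrite ltrBlDr ltrDl.
Qed.

(** The chains that start from e stay beyond every bi-infinite solution.  Hence their
limit is the h-largest solution, which identifies it whatever digits were used at
the intermediate stages. *)
Lemma solution_le_stage w n t : solution F z w -> (h (w t) <= h (stage n t))%N.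
Proof.
move=> wsol; rewrite /stage; move: t.
refine (@chain_ind (- n%:Z) _ _ _) => [t ts|t st IH].
  by rewrite (chain_from_lt _ _ _ ts) e_top.
rewrite (chain_fromE _ _ _ st) wsol.
apply: (update_mono F_mono) => // j; apply: IH.
by rewrite ltrBlDr ltrDl.
Qed.

Lemma stage_stabilizes t : exists a, (forall n, (h a <= h (stage n t))%N) /\
  \forall n \near \oo, stage n t = a.
Proof.
have hk : exists k, `[< exists n, h (stage n t) = k >].
  by exists (h (stage 0 t)); apply/asboolP; exists 0%N.
case: (ex_minnP hk) => k /asboolP[n nk] kmin.
have kle n' : (k <= h (stage n' t))%N by apply: kmin; apply/asboolP; exists n'.
exists (stage n t); split; first by move=> n'; rewrite nk.
exists n => // n' /= nn'; apply: h_inj; rewrite nk.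
apply/eqP; rewrite eqn_leq kle andbT -nk.
rewrite -(subnKC nn'); elim: (n' - n)%N => [|i IH]; first by rewrite addn0.
by rewrite addnS; apply: leq_trans (stage_mono _ _) IH.
Qed.

Definition stage_limit t : alphabet m := projT1 (cid (stage_stabilizes t)).

Lemma stage_limit_le n t : (h (stage_limit t) <= h (stage n t))%N.
Proof. by rewrite /stage_limit; case: cid => a []. Qed.

Lemma stage_limit_near t : \forall n \near \oo, stage n t = stage_limit t.
Proof. by rewrite /stage_limit; case: cid => a []. Qed.

Lemma stage_limit_solution : solution F z stage_limit.
Proof.
move=> t.
have c1 := @update_cont _ _ _ _ F_mono (fun n => zs n t) (z t)
  (fun n => past_at (stage n) t) (past_at stage_limit t) (fun n k => zs_z n t k)
  (fun n j => stage_limit_le n _) (zs_cvg t) (fun j => stage_limit_near _).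
have c2 : \forall n \near \oo, - n%:Z <= t.
  exists `|t|%N => // n /= tn; rewrite lerNl.
  apply: le_trans (_ : `|t|%:Z <= n%:Z); last by rewrite lez_nat.
  by rewrite abszE -normrN ler_norm.
have [n [/= e1 [e2 e3]]] := @filter_ex _ _ _ _
  (filterI c1 (filterI c2 (stage_limit_near t))).
by rewrite -e1 -e3 /stage chain_fromE.
Qed.

End stages.

Definition limit_chain z t : alphabet m :=
  xget e [set a | \forall n \near \oo, chain_from e F z (- n%:Z) t = a].

Lemma limit_chain_near z t :
  \forall n \near \oo, chain_from e F z (- n%:Z) t = limit_chain z t.
Proof.
rewrite /limit_chain; case: xgetP => // none.
have [] := @stage_stabilizes (fun=> z) (fun n t k => r_refl (z t k)) t.
by move=> a [_ /none].
Qed.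

Lemma limit_chain_solution z : solution F z (limit_chain z).
Proof.
have mon (n : nat) t k : r (z t k) (z t k) by exact: r_refl.
suff -> : limit_chain z = stage_limit (zs := fun=> z) mon.
  by apply: stage_limit_solution => // t k; exact: nearW.
apply/funext => t.
have [n [/= <- <-]] := @filter_ex _ _ _ _
  (filterI (limit_chain_near z t) (stage_limit_near (zs := fun=> z) mon t)).
by [].
Qed.

Lemma solution_le_limit_chain z w t : solution F z w ->
  (h (w t) <= h (limit_chain z t))%N.
Proof.
move=> wsol; have [n /= <-] := @filter_ex _ _ _ _ (limit_chain_near z t).
by apply: (@solution_le_stage (fun=> z)) wsol => *; exact: r_refl.
Qed.

(** Both sides are the h-largest solution driven by the digits z. *)
Lemma stage_cvg (zs : nat -> int -> nat -> bool) z t :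
  (forall n t k, r (zs n t k) (zs n.+1 t k)) ->
  (forall n t k, r (zs n t k) (z t k)) ->
  (forall t k, \forall n \near \oo, zs n t k = z t k) ->
  \forall n \near \oo, chain_from e F (zs n) (- n%:Z) t = limit_chain z t.
Proof.
move=> mon zsz cv; rewrite (_ : limit_chain z t = stage_limit mon t).
  exact: stage_limit_near.
apply/h_inj/eqP; rewrite eqn_leq.
rewrite (solution_le_limit_chain _ (stage_limit_solution mon zsz cv)) andbT.
have [n /= <-] := @filter_ex _ _ _ _ (stage_limit_near mon t).
exact: (@solution_le_stage zs z zsz _ n t (limit_chain_solution z)).
Qed.

(** Shifts of solutions are solutions for the shifted digits, so each side dominates
the other one. *)
Lemma limit_chain_shift z t :
  limit_chain (fun t => z (t + 1)) t = limit_chain z (t + 1).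
Proof.
apply/h_inj/eqP; rewrite eqn_leq; apply/andP; split.
  rewrite -{1}(addrK 1 t).
  apply: (@solution_le_limit_chain z (fun t => limit_chain (fun t => z (t + 1)) (t - 1))).
  move=> t'; rewrite {1}limit_chain_solution subrK; congr (F _ _).
  by apply/funext => j; rewrite /past_at addrAC.
apply: (@solution_le_limit_chain _ (fun t => limit_chain z (t + 1))) => t'.
rewrite {1}limit_chain_solution; congr (F _ _).
by apply/funext => j; rewrite /past_at addrAC.
Qed.

Lemma eq_limit_chain z z' t : (forall t', t' <= t -> z t' = z' t') ->
  limit_chain z t = limit_chain z' t.
Proof.
move=> zz'.
have [n [/= <- <-]] := @filter_ex _ _ _ _
  (filterI (limit_chain_near z t) (limit_chain_near z' t)).
by apply: eq_chain_from => t' /andP[_]; exact: zz'.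
Qed.

End convergence.
End chains.

(** * Stationarity and compatibility of the limit chain *)

Section independence_fubini.
Context {d d1 d2} {T : measurableType d} {T1 : measurableType d1}
  {T2 : measurableType d2} {R : realType} (P : probability T R).
Variables (f : T -> T1) (g : T -> T2).
Hypotheses (mf : measurable_fun setT f) (mg : measurable_fun setT g).
Hypothesis fg_indep : forall A B, measurable A -> measurable B ->
  P (f @^-1` A `&` g @^-1` B) = (P (f @^-1` A) * P (g @^-1` B))%E.

Lemma indep_fubini (C : set (T1 * T2)) : measurable C ->
  P [set w | C (f w, g w)] = (\int[P]_w P [set w' | C (f w, g w')])%E.
Proof.
move=> mC.
have mfg : measurable_fun setT (fun w => (f w, g w)) by exact: measurable_fun_pair.
pose Pf := image_law P mf; pose Pg := image_law P mg.
have E : ((Pf \x Pg) C = image_law P mfg C)%E.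
  by apply: product_measure_unique => // A B mA mB; exact: fg_indep.
rewrite image_lawE in E; rewrite -[LHS]E /product_measure1 /Pf /image_law /distribution.
rewrite ge0_integral_pushforward//=.
- apply: eq_integral => w _ /=; rewrite /Pg image_lawE.
  by congr (P _); apply/seteqP; split=> w' /=; rewrite /xsection /= inE.
- exact: measurable_fun_xsection.
Qed.

End independence_fubini.

Section chain_law.
Context {R : realType} {m : nat}.
Variables (P : alphabet m -> pasts m -> R).
Hypotheses (Pk : is_kernel P) (Pc : continuous_kernel P).
Variables (h : alphabet m -> nat) (r : rel bool) (e : alphabet m).
Variable F : (nat -> bool) -> pasts m -> alphabet m.
Hypotheses (h_inj : injective h) (r_refl : reflexive r).
Hypothesis e_top : forall a, (h a <= h e)%N.
Hypotheses (F_mono : monotone_update h r F) (F_sim : simulates P F).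

Local Notation bits := (seq_space (int * nat)%type bool).

Definition row (z : bits) (t : int) : seq_space nat bool := fun k => z (t, k).

Definition bits_chain (z : bits) : paths m := limit_chain e F (row z).

Lemma measurable_row t : measurable_fun setT (row ^~ t : bits -> _).
Proof. exact: (measurable_reindex (pair t)). Qed.

Lemma measurable_update x a :
  measurable [set z : seq_space nat bool | F z x = a].
Proof.
have := measurable_xsection x (update_measurable F_sim a); congr (measurable _).
by apply/seteqP; split=> z; rewrite /xsection /= inE.
Qed.

Lemma measurable_history s n l :
  measurable [set z : bits | history e (fun i => F (row z (s + i%:Z))) n = l].
Proof.
elim: n l => [|n IH] [|a l].
- by rewrite (_ : mkset _ = setT)//; apply/seteqP; split.
- by rewrite (_ : mkset _ = set0)//; apply/seteqP; split.
- by rewrite (_ : mkset _ = set0)//; apply/seteqP; split.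
rewrite (_ : mkset _ = [set z : bits | F (row z (s + n%:Z)) (nth e l) = a] `&`
    [set z : bits | history e (fun i => F (row z (s + i%:Z))) n = l]).
  apply: measurableI => //.
  have := measurable_row (s + n%:Z) measurableT (measurable_update (nth e l) a).
  by rewrite setTI.
by apply/seteqP; split=> z /= => [[<- <-]|[<- ->]].
Qed.

Lemma measurable_chain_from s t a :
  measurable [set z : bits | chain_from e F (row z) s t = a].
Proof.
rewrite /chain_from; case: (t - s) => n; last first.
  have [->|ea] := eqVneq e a; first by rewrite (_ : mkset _ = setT)//; apply/seteqP; split.
  rewrite (_ : mkset _ = set0)//; apply/seteqP; split=> // z /= /eqP.
  by rewrite (negbTE ea).
rewrite (_ : mkset _ = \bigcup_(l in [set l | head e l = a])
    [set z : bits | history e (fun i => F (row z (s + i%:Z))) n.+1 = l]).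
  rewrite bigcup_mkcond; apply: countable_bigcupT_measurable; first exact: countableP.
  by move=> l; case: ifP => // _; exact: measurable_history.
apply/seteqP; split=> z; first by move=> za; eexists; [exact: za|].
by move=> [l la hl]; rewrite -la -hl.
Qed.

Lemma measurable_bits_chain : measurable_fun setT bits_chain.
Proof.
apply: measurable_seq_space => [|t a]; first exact: countableP.
rewrite (_ : mkset _ = \bigcup_N \bigcap_(n in [set n | (N <= n)%N])
    [set z : bits | chain_from e F (row z) (- n%:Z) t = a]).
  apply: bigcup_measurable => N _; apply: bigcap_measurableType => n _.
  exact: measurable_chain_from.
apply/seteqP; split=> z /=.
  move=> za; have [N _ NP] := limit_chain_near h_inj r_refl e_top F_mono (row z) t.
  by exists N => // n /NP /= ->.
move=> [N _ NP].
have near_a : \forall n \near \oo, chain_from e F (row z) (- n%:Z) t = a by exists N.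
have [n [/= na nl]] := @filter_ex _ _ _ _ (filterI near_a
  (limit_chain_near h_inj r_refl e_top F_mono (row z) t)).
by rewrite -na nl.
Qed.

Lemma measurable_past_of : measurable_fun setT (@past_of m).
Proof.
apply: measurable_seq_space => [|j a]; first exact: countableP.
exact: (@coord_measurable int (alphabet m) _ (fun b => b = a)).
Qed.

Lemma bits_chain0 z : bits_chain z 0 = F (row z 0) (past_of (bits_chain z)).
Proof.
rewrite /bits_chain {1}(limit_chain_solution h_inj r_refl e_top F_mono).
by congr (F _ _); apply/funext => j; rewrite /past_at sub0r.
Qed.

Lemma bits_chain_local (z z' : bits) t :
  (forall t' k, t' <= t -> z (t', k) = z' (t', k)) -> bits_chain z t = bits_chain z' t.
Proof.
move=> zz'; apply: (eq_limit_chain h_inj r_refl e_top F_mono) => t' t't.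
by apply/funext => k; exact: zz'.
Qed.

Variable nu : probability bits R.
Hypothesis nu_fair : fair nu.

Lemma bits_chain_shift (z : bits) :
  bits_chain (fun i => z (i.1 + 1, i.2)) = path_shift (bits_chain z).
Proof.
by apply/funext => t; exact: (limit_chain_shift h_inj r_refl e_top F_mono (row z) t).
Qed.

Definition chain_law : probability (paths m) R := image_law nu measurable_bits_chain.

(** The shifted chain is the chain driven by the shifted coins, which are fair. *)
Lemma chain_law_stationary : stationary chain_law.
Proof.
move=> B mB.
change (nu (bits_chain @^-1` (path_shift @^-1` B)) = nu (bits_chain @^-1` B)).
pose shift (i : int * nat) := (i.1 + 1, i.2).
have shift_inj : injective shift.
  by move=> [t k] [t' k'] [/addIr -> ->].
have mXB : measurable (bits_chain @^-1` B).
  by have := measurable_bits_chain measurableT mB; rewrite setTI.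
apply: etrans (fair_unique (fair_reindex_law shift_inj nu_fair) nu_fair mXB).
apply: (congr1 nu); apply/seteqP; split=> z.
  by rewrite /preimage /= bits_chain_shift.
by rewrite /preimage /= bits_chain_shift.
Qed.

(** The negative part of the chain depends on the coins of negative times only. *)
Lemma past_row_indep (A : set (pasts m)) (B : set (seq_space nat bool)) :
  measurable A -> measurable B ->
  nu ((past_of \o bits_chain) @^-1` A `&` row ^~ 0%R @^-1` B)
  = (nu ((past_of \o bits_chain) @^-1` A) * nu (row ^~ 0%R @^-1` B))%E.
Proof.
move=> mA mB.
apply: (@fair_indep _ _ _ [set i | i.1 < 0] [set i | i.1 = 0]) => //.
- by move=> [t k] /= + t0; rewrite t0 ltxx.
- have := measurableT_comp measurable_past_of measurable_bits_chain.
  by move=> /(_ measurableT _ mA); rewrite setTI.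
- move=> u v uv; rewrite /preimage /=.
  rewrite (_ : past_of (bits_chain u) = past_of (bits_chain v))//.
  apply/funext => j; apply: bits_chain_local => t k tj; apply: uv => /=.
  by apply: le_lt_trans tj _; rewrite oppr_lt0.
- by have := measurable_row 0 measurableT mB; rewrite setTI.
- move=> u v uv; rewrite /preimage /=.
  by rewrite (_ : row u 0 = row v 0)//; apply/funext => k; exact: uv.
Qed.

(** The value at time 0 is the update of the past by independent fair digits, and
these are integrated out by Fubini's theorem. *)
Lemma chain_law_compatible : compatible P chain_law.
Proof.
move=> a; exists (P a); last first.
  by exists set0; split; rewrite ?measure0// => w /=.
split=> [|B mB]; first exact: measurable_kernel.
have mpast := measurableT_comp measurable_past_of measurable_bits_chain.
rewrite /chain_law /image_law ge0_integral_pushforward//=; last 4 first.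
- exact: measurable_bits_chain.
- by have := measurable_past_of measurableT mB; rewrite setTI.
- apply: measurable_funTS; apply/measurable_EFinP.
  apply: (measurableT_comp (f := P a)) => //; last exact: measurable_past_of.
  exact: measurable_kernel.
- by move=> w _; rewrite lee_fin; have /andP[] := Pk.1 a (past_of w).
rewrite [RHS]integral_mkcond.
pose C := [set xz : pasts m * seq_space nat bool | B xz.1 /\ F xz.2 xz.1 = a].
have mC : measurable C.
  apply: (@measurableI _ _ [set xz : pasts m * seq_space nat bool | B xz.1]).
    have := @measurable_fst _ _ (pasts m) (seq_space nat bool) measurableT B mB.
    by rewrite setTI.
  exact: (update_measurable F_sim a).
have := indep_fubini mpast (measurable_row 0) past_row_indep mC.
rewrite (_ : [set w | C _] =
  bits_chain @^-1` ([set w | w 0 = a] `&` past_of @^-1` B)); last first.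
  apply/seteqP; split=> z; rewrite /C /preimage /= bits_chain0; by case.
move=> H; apply: (etrans H); apply: eq_integral => z _; rewrite patchE; case: ifPn.
  rewrite inE /C /= => Bz.
  rewrite -(update_law F_sim _ a (fair_reindex_law (f := pair 0) _ nu_fair)).
    by apply: (congr1 nu); apply/seteqP; split=> z' /=; [case|split].
  by move=> k k' [].
rewrite notin_setE /C /= => nBz.
by rewrite (_ : mkset _ = set0) ?measure0//; apply/seteqP; split=> // z' [].
Qed.

End chain_law.

(** * Symbols that supply binary digits *)

Definition first_true (c : nat -> bool) : nat :=
  if pselect (exists k, c k) is left ex then ex_minn ex else 0.

Lemma first_true_spec (c : nat -> bool) k : c k ->
  c (first_true c) /\ forall j, (j < first_true c)%N -> ~~ c j.
Proof.
move=> ck; rewrite /first_true; case: pselect => [ex|[]]; last by exists k.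
case: ex_minnP => n cn nmin; split=> // j jn; apply/negP => /nmin.
by rewrite leqNgt jn.
Qed.

Lemma first_true_eq (c : nat -> bool) n :
  c n -> (forall j, (j < n)%N -> ~~ c j) -> first_true c = n.
Proof.
move=> cn nmin; have [cf fmin] := first_true_spec cn.
apply/eqP; rewrite eqn_leq; apply/andP; split; rewrite leqNgt; apply/negP.
  by move=> /fmin; rewrite cn.
by move=> /nmin; rewrite cf.
Qed.

Lemma first_true_local (c c' : nat -> bool) n :
  (forall d, (d < n)%N -> c d = c' d) ->
  (first_true c < n)%N -> c (first_true c) ->
  first_true c' = first_true c /\ c' (first_true c).
Proof.
move=> cc' fn cf; have [_ fmin] := first_true_spec cf.
have c'f : c' (first_true c) by rewrite -cc'.
split=> //; apply: first_true_eq => // j jf.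
by rewrite -cc' ?fmin// (ltn_trans jf).
Qed.

Lemma measurable_first_true n :
  measurable [set c : seq_space nat bool | first_true c = n].
Proof.
have mS k : measurable [set c : seq_space nat bool | first_true c = k.+1].
  apply: (@finite_coords_measurable nat bool (iota 0 k.+2)); first exact: countableP.
  move=> u v /eq_in_map uv /= uk.
  have cu : u (first_true u).
    move: uk; rewrite /first_true; case: pselect => // ex _.
    by case: ex_minnP.
  rewrite (@first_true_local u v k.+2 _ _ cu).1 ?uk// => d dk.
  by apply: uv; rewrite mem_iota.
case: n => // ; rewrite (_ : mkset _ = ~` \bigcup_k [set c | first_true c = k.+1]).
  by apply: measurableC; exact: bigcup_measurable.
apply/seteqP; split=> c /=; first by move=> c0 [k _ /=]; rewrite c0.
by case E : (first_true c) => [//|k] []; exists k.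
Qed.

(** A level and a table, whose row d holds the bits offered to the time d steps
later. *)
Definition symbol := (nat * seq (seq bool))%type.
HB.instance Definition _ := Countable.copy symbol (nat * seq (seq bool))%type.
HB.instance Definition _ := isPointed.Build symbol (0%N, [::]).

(** The delays that a level reaches grow like the square of the inverse of its
probability, so that a symbol of this level is found within reach with high
probability. *)
Definition covers (l d k : nat) : bool := (d < 4 ^ l.+1)%N && (k <= l)%N.

Definition lookup (a : symbol) (d k : nat) : bool := nth false (nth [::] a.2 d) k.

Definition tabulate (l : nat) (c : nat * nat -> bool) : seq (seq bool) :=
  mkseq (fun d => mkseq (fun k => c (d, k)) l.+1) (4 ^ l.+1).

Definition symbol_of (c : nat + nat * nat -> bool) : symbol :=
  let l := first_true (c \o inl) in (l, tabulate l (c \o inr)).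

Lemma lookup_symbol_of c d k : covers (symbol_of c).1 d k ->
  lookup (symbol_of c) d k = c (inr (d, k)).
Proof. by move=> /andP[dl kl]; rewrite /lookup /= !nth_mkseq. Qed.

Lemma measurable_symbol_of a :
  measurable [set c : seq_space (nat + nat * nat) bool | symbol_of c = a].
Proof.
case: a => l tb.
rewrite (_ : mkset _ =
    [set c : seq_space (nat + nat * nat) bool | first_true (c \o inl) = l] `&`
    [set c : seq_space (nat + nat * nat) bool | tabulate l (c \o inr) = tb]); last first.
  by apply/seteqP; split=> c; rewrite /mkset /symbol_of => -[<- <-].
apply: measurableI.
  have := @measurable_reindex _ _ (@inl nat (nat * nat)) measurableT _
    (measurable_first_true l).
  by rewrite setTI.
apply: (@finite_coords_measurable _ bool
  [seq inr (d, k) | d <- iota 0 (4 ^ l.+1), k <- iota 0 l.+1]); first exact: countableP.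
move=> u v /eq_in_map uv /= <-; apply/esym.
rewrite /tabulate; apply/eq_in_map => d dl; apply/eq_in_map => k kl.
by apply: uv; apply/allpairsP; exists (d, k).
Qed.

Section known_bits.
Implicit Types (u v : int -> symbol) (t : int) (k n : nat).

Definition source u t k : nat := first_true (fun d => covers (u (t - d%:Z)).1 d k).

Definition sourced u t k : bool :=
  covers (u (t - (source u t k)%:Z)).1 (source u t k) k.

Definition known_bit (dflt : bool) u t k : bool :=
  if sourced u t k then lookup (u (t - (source u t k)%:Z)) (source u t k) k else dflt.

(** The number of delays for which the supplying symbol of time t lies in the window
that starts at time -n. *)
Definition slots n t : nat := if (t + n%:Z)%R is Posz p then p.+1 else 0%N.

Definition stage_bit (dflt : bool) u n t k : bool :=
  if (source u t k < slots n t)%N then known_bit dflt u t k else dflt.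

Lemma leq_slots n n' t : (n <= n')%N -> (slots n t <= slots n' t)%N.
Proof.
move=> nn'; rewrite /slots.
have : t + n%:Z <= t + n'%:Z by rewrite lerD2l lez_nat.
by case: (t + n%:Z) => p; case: (t + n'%:Z).
Qed.

Lemma slots_gt N t : \forall n \near \oo, (N < slots n t)%N.
Proof.
exists (N + `|t|)%N => // n /= Nn.
have : N%:Z <= t + n%:Z.
  have : (N + `|t|)%N%:Z <= n%:Z by rewrite lez_nat.
  have : - t <= `|t|%N%:Z by rewrite abszE -normrN ler_norm.
  rewrite PoszD; lra.
by rewrite /slots; case: (t + n%:Z).
Qed.

Lemma stage_bit_cvg dflt u t k :
  \forall n \near \oo, stage_bit dflt u n t k = known_bit dflt u t k.
Proof.
near=> n; rewrite /stage_bit ifT//.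
by near: n; exact: slots_gt.
Unshelve. all: by end_near. Qed.

Lemma stage_bit_mono (r : rel bool) dflt u n t k :
  (forall b, r dflt b) -> reflexive r ->
  r (stage_bit dflt u n t k) (stage_bit dflt u n.+1 t k).
Proof.
move=> rd rr; rewrite /stage_bit; case: ifP => // sn.
by rewrite ifT// (leq_trans sn)// leq_slots.
Qed.

Lemma stage_bit_known (r : rel bool) dflt u n t k :
  (forall b, r dflt b) -> reflexive r ->
  r (stage_bit dflt u n t k) (known_bit dflt u t k).
Proof. by move=> rd rr; rewrite /stage_bit; case: ifP. Qed.

Lemma known_bit_shift dflt u t k :
  known_bit dflt (path_shift u) t k = known_bit dflt u (t + 1) k.
Proof.
have E (d : nat) : path_shift u (t - d%:Z) = u (t + 1 - d%:Z).
  by rewrite /path_shift addrAC.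
have sE : source (path_shift u) t k = source u (t + 1) k.
  by congr first_true; apply/funext => d; rewrite E.
by rewrite /known_bit /sourced sE E.
Qed.

(** The source is defined by an unbounded search, but whether it is found inside the
window can be decided from the window. *)
Lemma stage_bit_local dflt u v n t k : - n%:Z <= t ->
  (forall i, - n%:Z <= i <= t -> u i = v i) ->
  stage_bit dflt u n t k = stage_bit dflt v n t k.
Proof.
move=> nt uv.
have uvd d : (d < slots n t)%N -> u (t - d%:Z) = v (t - d%:Z).
  move=> dn; apply: uv; rewrite lerBlDr lerDl lez_nat leq0n andbT.
  move: dn; rewrite /slots; case E : (t + n%:Z) => [p|//]; rewrite ltnS -lez_nat -E.
  lra.
have key w w' : (forall d, (d < slots n t)%N -> w (t - d%:Z) = w' (t - d%:Z)) ->
    (source w t k < slots n t)%N -> sourced w t k ->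
    source w' t k = source w t k /\ sourced w' t k.
  move=> ww' sn sw.
  have [//|s' c'] :=
    @first_true_local _ (fun d => covers (w' (t - d%:Z)).1 d k) _ _ sn sw.
    by move=> d dn; rewrite ww'.
  by split=> //; rewrite /sourced /source s'.
rewrite /stage_bit /known_bit.
have [su|nsu] := boolP ((source u t k < slots n t)%N && sourced u t k).
  have /andP[su1 su2] := su.
  have [-> ->] := key u v uvd su1 su2.
  by rewrite su1 su2 uvd.
have : ~~ ((source v t k < slots n t)%N && sourced v t k).
  apply: contra nsu => /andP[sv1 sv2].
  have [-> ->] := key v u (fun d dn => esym (uvd d dn)) sv1 sv2.
  by rewrite sv1.
by move: nsu; do 2! case: (_ < _)%N; do 2! case: sourced.
Qed.

Lemma known_bit_local dflt u v t k :
  (forall i, i <= t -> u i = v i) -> known_bit dflt u t k = known_bit dflt v t k.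
Proof.
move=> uv.
have E (d : nat) : u (t - d%:Z) = v (t - d%:Z).
  by apply: uv; rewrite lerBlDr lerDl lez_nat.
have sE : source u t k = source v t k.
  by congr first_true; apply/funext => d; rewrite E.
by rewrite /known_bit /sourced sE E.
Qed.

End known_bits.

(** * The law of the symbols and of the digits they supply *)

Section coins.
Context {R : realType}.

Local Notation coin_index := (int * (nat + nat * nat))%type.

Definition coins : probability (seq_space coin_index bool) R := fair_coins coin_index.

Lemma fair_coins_coins : fair coins.
Proof. exact: fair_fair_coins. Qed.

Definition symbols (y : seq_space coin_index bool) : seq_space int symbol :=
  fun i => symbol_of (fun c => y (i, c)).

Lemma measurable_symbol_pred i (B : set symbol) :
  measurable [set y : seq_space coin_index bool | B (symbols y i)].
Proof.
rewrite (_ : mkset _ = \bigcup_(a in B) [set y | symbols y i = a]); last first.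
  apply/seteqP; split=> y /=; first by move=> By; exists (symbols y i).
  by move=> [a Ba ya]; rewrite -ya in Ba.
rewrite bigcup_mkcond; apply: countable_bigcupT_measurable; first exact: countableP.
move=> a; case: ifP => // _.
have := @measurable_reindex _ _ (pair i) measurableT _ (measurable_symbol_of a).
by rewrite setTI.
Qed.

Lemma measurable_symbols : measurable_fun setT symbols.
Proof.
apply: measurable_seq_space => [|i a]; first exact: countableP.
exact: (measurable_symbol_pred i (fun b => b = a)).
Qed.

Definition symbol_law : probability (seq_space int symbol) R :=
  image_law coins measurable_symbols.

Lemma measurable_symbol_events (s : seq int) (B : int -> set symbol) :
  measurable [set u : seq_space int symbol | forall i, i \in s -> B i (u i)].
Proof.
apply: (@finite_coords_measurable int symbol s); first exact: countableP.
by move=> u v /eq_in_map uv /= uB i si; rewrite -uv//; exact: uB.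
Qed.

Lemma symbol_law_marginal i (B : set symbol) :
  symbol_law [set u | B (u i)] = symbol_law [set u | B (u 0)].
Proof.
have E j : symbol_law [set u | B (u j)]
    = fair_coins (nat + nat * nat)%type [set c | B (symbol_of c)].
  have mB : measurable [set c : seq_space (nat + nat * nat) bool | B (symbol_of c)].
    rewrite (_ : mkset _ = \bigcup_(a in B) [set c | symbol_of c = a]); last first.
      apply/seteqP; split=> y /=; first by move=> By; exists (symbol_of y).
      by move=> [a Ba ya]; rewrite -ya in Ba.
    rewrite bigcup_mkcond; apply: countable_bigcupT_measurable; first exact: countableP.
    by move=> a; case: ifP => // _; exact: measurable_symbol_of.
  have pair_inj : injective (pair j : nat + nat * nat -> coin_index).
    by move=> c c' [].
  exact: (fair_unique (fair_reindex_law pair_inj fair_coins_coins)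
    (@fair_fair_coins R _) mB).
by rewrite !E.
Qed.

Lemma symbol_law_iid : iid_law symbol_law.
Proof.
split=> [i B|J B]; first exact: symbol_law_marginal.
suff H s : uniq s -> symbol_law [set u | forall i, i \in s -> B i (u i)]
    = (\prod_(i <- s) symbol_law [set u | B i (u i)])%E.
  exact: H (fset_uniq J).
elim: s => [|i s IH] /=.
  rewrite big_nil => _; rewrite (_ : mkset _ = setT) ?probability_setT//.
  by rewrite -subTset => u _ i; rewrite in_nil.
move=> /andP[si us]; rewrite big_cons -IH//.
pose Y1 := [set y : seq_space coin_index bool | B i (symbols y i)].
pose Y2 := [set y : seq_space coin_index bool | forall j, j \in s -> B j (symbols y j)].
transitivity (coins (Y1 `&` Y2)).
  apply: (congr1 coins); apply/seteqP; split=> y /=.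
    by move=> uB; split=> [|j js]; apply: uB; rewrite inE ?eqxx// js orbT.
  by move=> [Bi Bs] j; rewrite inE => /orP[/eqP ->|/Bs].
apply: (@fair_indep _ _ _ [set c : coin_index | c.1 = i] [set c | c.1 \in s]).
- exact: fair_coins_coins.
- by move=> c /= ->; rewrite (negbTE si).
- exact: measurable_symbol_pred.
- move=> y y' yy'; rewrite /Y1 /= /symbols.
  rewrite (_ : (fun c => y (i, c)) = (fun c => y' (i, c)))//.
  by apply/funext => c; exact: yy'.
- by have := measurable_symbols measurableT (measurable_symbol_events s B); rewrite setTI.
- move=> y y' yy'; rewrite /Y2 /= /symbols => yB j sj.
  rewrite (_ : (fun c => y' (j, c)) = (fun c => y (j, c))); first exact: yB.
  by apply/funext => c; rewrite yy'.
Qed.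

Lemma bernoulli_inverse (p : R) n : 0 <= p <= 1 -> (1 - p) ^+ n * (1 + p *+ n) <= 1.
Proof.
move=> /andP[p0 p1].
have B : 1 + p *+ n <= (1 + p) ^+ n.
  elim: n => [|n IH]; first by rewrite mulr0n addr0 expr0.
  rewrite exprS; apply: (@le_trans _ _ ((1 + p) * (1 + p *+ n))).
    rewrite mulrDl mul1r mulrDr mulr1 mulrS.
    have : 0 <= p * (p *+ n) by rewrite mulr_ge0// mulrn_wge0.
    lra.
  by rewrite ler_pM2l//; lra.
apply: (@le_trans _ _ ((1 - p) ^+ n * (1 + p) ^+ n)).
  by rewrite ler_wpM2l// exprn_ge0//; lra.
by rewrite -exprMn exprn_ile1//; nra.
Qed.

Lemma card_imfset_iota (T : choiceType) (f : nat -> T) n : injective f ->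
  #|` [fset f j | j in iota 0 n]%fset| = n.
Proof. by move=> f_inj; rewrite card_imfset//= undup_id ?size_iota ?iota_uniq. Qed.

(** Level l is forced by l bits equal to 0 followed by a bit equal to 1. *)
Lemma symbol_law_level l :
  (((2^-1) ^+ l.+1)%:E <= symbol_law [set u : seq_space int symbol | (u 0%R).1 = l])%E.
Proof.
pose F := [fset ((0 : int), (inl j : nat + nat * nat)) | j in iota 0 l.+1]%fset.
pose e (c : coin_index) := if c.2 is inl j then j == l else false.
have FE : (coins (cylinder F e) = ((2^-1) ^+ l.+1)%:E)%E.
  by rewrite fair_coins_coins card_imfset_iota// => j j' [].
rewrite -FE; apply: le_measure; rewrite ?inE.
- exact: measurable_cylinder.
- exact: (measurable_symbol_pred 0 (fun a => a.1 = l)).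
move=> y yF; rewrite /preimage /= /symbols /symbol_of /=.
have yE j : (j <= l)%N -> y (0, inl j) = (j == l).
  move=> jl; have ji : j \in iota 0 l.+1 by rewrite mem_iota ltnS.
  by rewrite yF//; apply: in_imfset.
apply: first_true_eq => [|j jl].
  by have := yE l (leqnn l); rewrite eqxx.
by have := yE j (ltnW jl); rewrite (ltn_eqF jl) => /negbT.
Qed.

Lemma measurable_unsourced t k :
  measurable [set u : seq_space int symbol | ~ sourced u t k].
Proof.
rewrite (_ : mkset _ =
    \bigcap_d [set u : seq_space int symbol | ~ covers (u (t - d%:Z)).1 d k]).
  apply: bigcap_measurableType => d _.
  exact: (@coord_measurable int symbol _ (fun a => ~ covers a.1 d k)).
apply/seteqP; split=> u /=.
  move=> ns d _ /= cd; apply: ns.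
  by have [] := @first_true_spec (fun d => covers (u (t - d%:Z)).1 d k) d cd.
by move=> nc; exact: (nc _ I).
Qed.

(** A digit of rank k without source sees no symbol of level l among 4^(l+1)
symbols, for any l >= k.  By Bernoulli's inequality, with p = 2^-(l+1), this has
probability at most (1 - p)^(4^(l+1)) <= 1 / (1 + 2^(l+1)). *)
Lemma symbol_law_unsourced t k : symbol_law [set u | ~ sourced u t k] = 0%E.
Proof.
have bound l : (k <= l)%N ->
    (symbol_law [set u | ~ sourced u t k] <= ((2^-1) ^+ l.+1)%:E)%E.
  move=> kl.
  pose J := [fset t - d%:Z | d in iota 0 (4 ^ l.+1)]%fset.
  pose a := fine (symbol_law [set u | (u 0).1 <> l]).
  have m0 : measurable [set u : seq_space int symbol | (u 0).1 = l].
    exact: (@coord_measurable int symbol 0 (fun b => b.1 = l)).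
  have aE : symbol_law [set u | (u 0).1 <> l] = a%:E.
    by rewrite fineK// fin_num_measure//; exact: measurableC.
  have a0 : 0 <= a by rewrite -lee_fin -aE measure_ge0.
  have a1 : a <= 1 - (2^-1) ^+ l.+1.
    rewrite -lee_fin -aE (_ : mkset _ = ~` [set u | (u 0).1 = l])//.
    rewrite probability_setC// EFinB; apply: leeB => //.
    exact: symbol_law_level.
  have JE : symbol_law [set u | forall i, i \in J -> (u i).1 <> l]
      = (a ^+ (4 ^ l.+1))%:E.
    have := symbol_law_iid.2 J (fun _ b => b.1 <> l); rewrite /= => ->.
    rewrite (eq_bigr (fun=> a%:E)); last first.
      by move=> i _; exact: etrans (symbol_law_marginal i (fun b => b.1 <> l)) aE.
    rewrite prodEFin big_const_seq count_predT iter_mulr_1; congr (_ ^+ _)%:E.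
    by apply: card_imfset_iota => d d' /addrI /oppr_inj [].
  apply: (@le_trans _ _ (a ^+ (4 ^ l.+1))%:E).
    rewrite -JE; apply: le_measure; rewrite ?inE.
    - exact: measurable_unsourced.
    - exact: (measurable_symbol_events (enum_fset J) (fun _ b => b.1 <> l)).
    move=> u /= ns i /imfsetP[d /=]; rewrite mem_iota /= add0n => dl -> ul.
    apply: ns.
    have cd : covers (u (t - d%:Z)).1 d k by rewrite ul /covers dl kl.
    by have [] := @first_true_spec (fun d => covers (u (t - d%:Z)).1 d k) d cd.
  rewrite lee_fin; set p : R := (2^-1) ^+ l.+1 in a1 *.
  have p01 : 0 <= p <= 1.
    by rewrite exprn_ge0 ?exprn_ile1 ?invr_ge0//= invf_le1// ler1n.
  apply: (@le_trans _ _ ((1 - p) ^+ (4 ^ l.+1))).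
    by apply: lerXn2r; rewrite ?nnegrE//; lra.
  have p2 : p * 2 ^+ l.+1 = 1 by rewrite -exprMn mulVf ?expr1n.
  have pn : p *+ (4 ^ l.+1) = 2 ^+ l.+1.
    rewrite -[LHS]mulr_natr natrX (_ : 4%:R = 2 * 2 :> R); last by ring.
    by rewrite exprMn mulrA p2 mul1r.
  have := bernoulli_inverse (4 ^ l.+1) p01; rewrite pn => hb.
  have c0 : 0 <= (1 - p) ^+ (4 ^ l.+1) by rewrite exprn_ge0//; lra.
  set c := (1 - p) ^+ _ in hb c0 *.
  have p0 : 0 < p by rewrite exprn_gt0// invr_gt0.
  have e1 : c = c * 2 ^+ l.+1 * p by rewrite -mulrA (mulrC _ p) p2 mulr1.
  rewrite e1 -[leRHS]mul1r ler_pM2r//.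
  lra.
apply/eqP; rewrite eq_le measure_ge0 andbT leNgt; apply/negP => Q0.
have fin : symbol_law [set u | ~ sourced u t k] \is a fin_num.
  by apply: fin_num_measure; exact: measurable_unsourced.
have [n hn] : exists n, (2^-1 : R) ^+ n < fine (symbol_law [set u | ~ sourced u t k]) - 0.
  by apply: halves_lt; rewrite -lte_fin fineK.
have := bound (maxn k n) (leq_maxl _ _).
rewrite -(fineK fin) lee_fin leNgt => /negP; apply.
rewrite subr0 in hn; apply: le_lt_trans hn.
by rewrite ler_wiXn2l ?invr_ge0// ?invf_le1 ?ler1n// (leq_trans (leq_maxr k n)).
Qed.

Definition level_bits (y : seq_space coin_index bool) :
    seq_space (int * nat) bool :=
  fun p => y (p.1, inl p.2).

Definition table_bits (y : seq_space coin_index bool) :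
    seq_space (int * (nat * nat)) bool := fun p => y (p.1, inr p.2).

Definition level_source (y1 : seq_space (int * nat) bool) t k : nat :=
  first_true (fun d => covers (first_true (fun j => y1 (t - d%:Z, j))) d k).

Lemma measurable_level_source t k d :
  measurable [set y1 | level_source y1 t k = d].
Proof.
pose c (y1 : seq_space (int * nat) bool) : seq_space nat bool :=
  fun d => covers (first_true (fun j => y1 (t - d%:Z, j))) d k.
suff mc : measurable_fun setT c.
  by have := mc measurableT _ (measurable_first_true d); rewrite setTI.
apply: measurable_seq_space => [|d' b]; first exact: countableP.
rewrite (_ : mkset _ = \bigcup_(l in [set l | covers l d' k = b])
    [set y1 | first_true (fun j => y1 (t - d'%:Z, j)) = l]); last first.
  apply/seteqP; split=> y1 /=; first by move=> yb; eexists; [exact: yb|].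
  by move=> [l /= lb yl]; rewrite /c yl.
rewrite bigcup_mkcond; apply: countable_bigcupT_measurable; first exact: countableP.
move=> l; case: ifP => // _.
have := @measurable_reindex _ _ (pair (t - d'%:Z)) measurableT _ (measurable_first_true l).
by rewrite setTI.
Qed.

(** The levels y1 and the tables y2 are separate arguments because, with y1 fixed,
the digits are a reindexing of y2 along an injection. *)
Definition allocate (y1 : seq_space (int * nat) bool)
    (y2 : seq_space (int * (nat * nat)) bool) (p : int * nat) : bool :=
  let d := level_source y1 p.1 p.2 in y2 (p.1 - d%:Z, (d, p.2)).

Lemma measurable_allocate p b :
  measurable [set yy :
      seq_space (int * nat) bool * seq_space (int * (nat * nat)) bool | allocate yy.1 yy.2 p = b].
Proof.
rewrite (_ : mkset _ = \bigcup_d ([set y1 | level_source y1 p.1 p.2 = d] `*`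
    [set y2 | y2 (p.1 - d%:Z, (d, p.2)) = b])).
  apply: bigcup_measurable => d _; apply: measurableX.
    exact: measurable_level_source.
  exact: (@coord_measurable _ bool _ (fun c => c = b)).
apply/seteqP; split=> -[y1 y2] /=; first by move=> yb; exists (level_source y1 p.1 p.2).
by move=> [d _ [/= <-]].
Qed.

Definition allocated_bits (y : seq_space coin_index bool) :
    seq_space (int * nat) bool :=
  allocate (level_bits y) (table_bits y).

Lemma measurable_level_bits : measurable_fun setT level_bits.
Proof. exact: (measurable_reindex (fun p : int * nat => (p.1, inl p.2))). Qed.

Lemma measurable_table_bits : measurable_fun setT table_bits.
Proof. exact: (measurable_reindex (fun p : int * (nat * nat) => (p.1, inr p.2))). Qed.

Lemma measurable_allocated_bits : measurable_fun setT allocated_bits.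
Proof.
apply: measurable_seq_space => [|p b]; first exact: countableP.
have := measurable_fun_pair measurable_level_bits measurable_table_bits.
by move=> /(_ measurableT _ (measurable_allocate p b)); rewrite setTI.
Qed.

Lemma level_table_indep A B : measurable A -> measurable B ->
  coins (level_bits @^-1` A `&` table_bits @^-1` B)
  = (coins (level_bits @^-1` A) * coins (table_bits @^-1` B))%E.
Proof.
move=> mA mB.
apply: (@fair_indep _ _ _ [set c | exists j, c.2 = inl j]
  [set c | exists j, c.2 = inr j]).
- exact: fair_coins_coins.
- by move=> [i c] [j /= ->] [].
- by have := measurable_level_bits measurableT mA; rewrite setTI.
- move=> y y' yy'; rewrite /preimage /=.
  rewrite (_ : level_bits y = level_bits y')//.
  by apply/funext => p; apply: yy'; exists p.2.
- by have := measurable_table_bits measurableT mB; rewrite setTI.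
- move=> y y' yy'; rewrite /preimage /=.
  rewrite (_ : table_bits y = table_bits y')//.
  by apply/funext => p; apply: yy'; exists p.2.
Qed.

(** Levels and tables are independent.  Given the levels, distinct digits read
distinct entries, since the entry (d, k) of the symbol of time i can only be the
digit of rank k of time i + d; so the digits are fair for every value of the
levels. *)
Lemma fair_allocated_bits : fair (image_law coins measurable_allocated_bits).
Proof.
move=> F e; rewrite image_lawE.
pose C := [set yy : seq_space (int * nat) bool * seq_space (int * (nat * nat)) bool |
  forall p, p \in F -> allocate yy.1 yy.2 p = e p].
have mC : measurable C.
  rewrite (_ : C = ~` \bigcup_(p in [set p | p \in F])
      [set yy | allocate yy.1 yy.2 p = ~~ e p]); last first.
    apply/seteqP; split=> yy; first by move=> yC [p pF /=]; rewrite yC//; case: (e p).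
    move=> nU p pF; apply/eqP; case: eqP => // ne; exfalso; apply: nU; exists p => //=.
    by move: ne; case: allocate; case: (e p).
  apply: measurableC; rewrite bigcup_mkcond.
  apply: countable_bigcupT_measurable; first exact: countableP.
  by move=> p; case: ifP => // _; exact: measurable_allocate.
have := indep_fubini measurable_level_bits measurable_table_bits level_table_indep mC.
rewrite (_ : [set w | C _] = allocated_bits @^-1` cylinder F e)// => ->.
transitivity (\int[coins]_w (cst ((2^-1) ^+ #|` F|)%:E : _ -> \bar R) w)%E; last first.
  by rewrite integral_cst//= [X in (_ * X)%E](probability_setT coins) mule1.
apply: eq_integral => y _.
pose f (p : int * nat) : coin_index :=
  let d := level_source (level_bits y) p.1 p.2 in (p.1 - d%:Z, inr (d, p.2)).
apply: (@fair_reindex _ _ _ f _ _ fair_coins_coins).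
by move=> [t k] [t' k'] [/= + dd kk]; rewrite dd kk => /addIr ->.
Qed.

Lemma known_bit_allocated dflt y t k : sourced (symbols y) t k ->
  known_bit dflt (symbols y) t k = allocated_bits y (t, k).
Proof.
move=> s; rewrite /known_bit s.
exact: (lookup_symbol_of (c := fun c => y (t - (source (symbols y) t k)%:Z, c)) s).
Qed.

End coins.

(** * The limit chain as a function of the symbols *)

Lemma null_set_measure_eq d (T : measurableType d) (R : realType)
    (P : probability T R) (N A B : set T) :
  measurable N -> P N = 0%E -> measurable A -> measurable B ->
  (forall w, ~ N w -> A w <-> B w) -> P A = P B.
Proof.
move=> mN N0 mA mB AB.
have E (C : set T) : measurable C -> P C = P (C `\` N).
  move=> mC; have CN : P (C `&` N) = 0%E.
    apply/eqP; rewrite eq_le measure_ge0 andbT -N0.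
    by apply: le_measure; rewrite ?inE//; exact: measurableI.
  by have := measureDI P mC mN; rewrite /= CN adde0.
rewrite (E A mA) (E B mB); apply: (congr1 P).
by apply/seteqP; split=> w [Cw nN]; split=> //; apply/(AB w nN).
Qed.

Section output.
Context {R : realType} {m : nat}.
Variables (P : alphabet m -> pasts m -> R).
Hypotheses (Pk : is_kernel P) (Pc : continuous_kernel P).
Variables (h : alphabet m -> nat) (r : rel bool) (e : alphabet m) (dflt : bool).
Variable F : (nat -> bool) -> pasts m -> alphabet m.
Hypotheses (h_inj : injective h) (r_refl : reflexive r).
Hypothesis r_dflt : forall b, r dflt b.
Hypothesis e_top : forall a, (h a <= h e)%N.
Hypotheses (F_mono : monotone_update h r F) (F_sim : simulates P F).

Definition output (u : seq_space int symbol) : paths m :=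
  limit_chain e F (known_bit dflt u).

Definition stage_output n (u : seq_space int symbol) (t : int) : alphabet m :=
  chain_from e F (stage_bit dflt u n) (- n%:Z) t.

Lemma stage_output_local n u v t :
  (forall i : int, - n%:Z <= i <= t -> u i = v i) ->
  stage_output n u t = stage_output n v t.
Proof.
move=> uv; apply: eq_chain_from => t' /andP[nt' t't].
apply/funext => k; apply: stage_bit_local => // i /andP[ni it'].
by apply: uv; rewrite ni (le_trans it').
Qed.

(** The digits known at the stages converge along r to those of the limit. *)
Lemma stage_output_near u t :
  \forall n \near \oo, stage_output n u t = output u t.
Proof.
apply: (stage_cvg h_inj r_refl e_top F_mono) => *.
- exact: stage_bit_mono.
- exact: stage_bit_known.
- exact: stage_bit_cvg.
Qed.

Lemma output_le_stage n u t : (h (output u t) <= h (stage_output n u t))%N.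
Proof.
apply: (solution_le_stage e_top F_mono (z := known_bit dflt u)).
  by move=> *; exact: stage_bit_known.
exact: limit_chain_solution h_inj r_refl e_top F_mono _.
Qed.

Lemma output_shift u : output (path_shift u) = path_shift (output u).
Proof.
apply/funext => t.
apply: etrans (limit_chain_shift h_inj r_refl e_top F_mono (known_bit dflt u) t).
congr (limit_chain e F _ t); apply/funext => t'; apply/funext => k.
exact: known_bit_shift.
Qed.

Lemma output_local u v t : (forall i, i <= t -> u i = v i) -> output u t = output v t.
Proof.
move=> uv; apply: (eq_limit_chain h_inj r_refl e_top F_mono) => t' t't.
apply/funext => k; apply: known_bit_local => i it'; apply: uv.
exact: le_trans it' t't.
Qed.

Lemma measurable_stage_output n t (Q : alphabet m -> Prop) :
  measurable [set u | Q (stage_output n u t)].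
Proof.
apply: (@finite_coords_measurable int symbol
  [seq - n%:Z + i%:Z | i <- iota 0 `|t + n%:Z|.+1]); first exact: countableP.
move=> u v /eq_in_map uv /=; rewrite (@stage_output_local n u v)// => i /andP[ni it].
apply: uv; apply/mapP; exists `|(i + n%:Z)%R|%N.
  rewrite mem_iota /= add0n ltnS -lez_nat !abszE.
  by rewrite !ger0_norm; lra.
by rewrite abszE ger0_norm; lra.
Qed.

Lemma measurable_output : measurable_fun setT output.
Proof.
apply: measurable_seq_space => [|t a]; first exact: countableP.
rewrite (_ : mkset _ = \bigcup_N \bigcap_(n in [set n | (N <= n)%N])
    [set u | stage_output n u t = a]).
  apply: bigcup_measurable => N _; apply: bigcap_measurableType => n _.
  exact: (measurable_stage_output n t (fun b => b = a)).
apply/seteqP; split=> u /=.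
  move=> ua; have [N _ NP] := stage_output_near u t.
  by exists N => // n /NP /= ->.
move=> [N _ NP].
have near_a : \forall n \near \oo, stage_output n u t = a by exists N.
have [n [/= na nl]] := @filter_ex _ _ _ _ (filterI near_a (stage_output_near u t)).
by rewrite -na nl.
Qed.

(** Outside the null set where some digit has no source, the output is the limit
chain driven by the allocated digits.  These are fair, so its law is stationary and
compatible, hence equal to mu. *)
Lemma output_law (mu : probability (paths m) R) (B : set (paths m)) :
  unique_compatible_chain P mu -> measurable B ->
  @symbol_law R (output @^-1` B) = mu B.
Proof.
move=> [_ _ mu_unique] mB.
pose nu : probability _ R := image_law (@coins R) measurable_allocated_bits.
have fnu : fair nu by exact: fair_allocated_bits.
rewrite -(mu_unique (chain_law h_inj r_refl e_top F_mono F_sim nu))//; last 2 first.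
- exact: chain_law_stationary.
- exact: chain_law_compatible.
pose Nn n : set (seq_space (int * (nat + nat * nat))%type bool) :=
  if @choice.unpickle (int * nat)%type n is Some p
  then symbols @^-1` [set u | ~ sourced u p.1 p.2] else set0.
pose N := \bigcup_n Nn n.
pose X := @bits_chain m e F.
have mX := measurable_bits_chain h_inj r_refl e_top F_mono F_sim.
have msym (A : set (seq_space int symbol)) : measurable A -> measurable (symbols @^-1` A).
  by move=> mA; have := measurable_symbols measurableT mA; rewrite setTI.
have mNn n : measurable (Nn n).
  rewrite /Nn; case: choice.unpickle => [p|]; last exact: measurable0.
  by apply: msym; exact: measurable_unsourced.
have mN : measurable N by exact: bigcup_measurable.
have N0 : @coins R N = 0%E.
  apply: measure_negligible => //; apply: negligible_bigcup => n.
  suff Nn0 : @coins R (Nn n) = 0%E by exists (Nn n); split.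
  rewrite /Nn; case: choice.unpickle => [p|]; last exact: measure0.
  exact: symbol_law_unsourced.
change (@coins R (symbols @^-1` (output @^-1` B)) =
  @coins R (allocated_bits @^-1` (X @^-1` B))).
apply: (@null_set_measure_eq _ _ _ _ N) => //.
- by apply: msym; have := measurable_output measurableT mB; rewrite setTI.
- have mXB : measurable (X @^-1` B) by have := mX measurableT B mB; rewrite setTI.
  by have := measurable_allocated_bits measurableT mXB; rewrite setTI.
move=> y nN; rewrite /preimage /=.
rewrite (_ : output (symbols y) = X (allocated_bits y))//.
rewrite /output /X /bits_chain; congr (limit_chain e F _).
apply/funext => t; apply/funext => k; apply: known_bit_allocated.
apply: contrapT => ns; apply: nN; exists (choice.pickle (t, k)) => //.
by rewrite /Nn choice.pickleK.
Qed.

End output.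

(** * Coalescence of the upper and the lower chain *)

Section coalescence.
Context {R : realType} {m : nat}.
Variables (P : alphabet m -> pasts m -> R) (mu : probability (paths m) R).
Hypotheses (Pk : is_kernel P) (Pa : attractive P) (Pc : continuous_kernel P).
Hypothesis mu_unique : unique_compatible_chain P mu.

Local Notation up := (output ord_max false (up_update P)).
Local Notation low := (output ord0 true (low_update P)).
Local Notation stage_up := (stage_output ord_max false (up_update P)).
Local Notation stage_low := (stage_output ord0 true (low_update P)).

Let up_inj : injective (fun a : alphabet m => a : nat). Proof. exact: val_inj. Qed.
Let up_refl : reflexive implb. Proof. by case. Qed.
Let up_dflt b : implb false b. Proof. by []. Qed.
Let up_top (a : alphabet m) : (a <= (ord_max : alphabet m))%N.
Proof. exact: leq_ord. Qed.

Let low_inj : injective (fun a : alphabet m => m - a)%N.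
Proof.
move=> a b ab; apply/val_inj.
by rewrite /= -(subKn (leq_ord a)) ab subKn ?leq_ord.
Qed.
Let low_refl : reflexive (fun c c' : bool => c' ==> c). Proof. by case. Qed.
Let low_dflt b : b ==> true. Proof. by case: b. Qed.
Let low_top (a : alphabet m) : (m - a <= m - (ord0 : alphabet m))%N.
Proof. by rewrite subn0 leq_subr. Qed.

Let up_mono := up_update_monotone Pk Pa Pc.
Let low_mono := low_update_monotone Pk Pa Pc.
Let up_sim := up_update_simulates Pk Pc.
Let low_sim := low_update_simulates Pk Pc.

Lemma up_le_stage n u : (up u 0 <= stage_up n u 0)%N.
Proof. exact: (output_le_stage up_inj up_refl up_dflt up_top up_mono). Qed.

Lemma stage_le_low n u : (stage_low n u 0 <= low u 0)%N.
Proof.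
have := output_le_stage low_inj low_refl low_dflt low_top low_mono n u 0.
by rewrite leq_sub2lE// leq_ord.
Qed.

(** The inequality holds everywhere, also where digits are missing, because missing
digits are 0 for the upper chain and 1 for the lower one. *)
Lemma low_le_up u : (low u 0 <= up u 0)%N.
Proof.
have [n [/= nl nu]] := @filter_ex _ _ _ _ (filterI
  (limit_chain_near low_inj low_refl low_top low_mono (known_bit true u) 0)
  (limit_chain_near up_inj up_refl up_top up_mono (known_bit false u) 0)).
rewrite /output -nl -nu.
apply: le_chain_from => // t x x' xx'.
apply: low_update_le_up_update => // k.
by rewrite /known_bit; case: ifP => // _; case: lookup.
Qed.

Definition coalescence_time (u : seq_space int symbol) : option nat :=
  if pselect (exists n, stage_up n u 0 == stage_low n u 0) is left ex
  then Some (ex_minn ex) else None.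

Lemma coalescence_timeP u k : coalescence_time u = Some k <->
  stage_up k u 0 = stage_low k u 0 /\
  forall n, (n < k)%N -> stage_up n u 0 <> stage_low n u 0.
Proof.
rewrite /coalescence_time; case: pselect => [ex|nex]; last first.
  by split=> // -[kE _]; exfalso; apply: nex; exists k; apply/eqP.
case: ex_minnP => n /eqP nE nmin; split=> [[<-]|[kE kmin]].
  by split=> // n' n'n /eqP /nmin; rewrite leqNgt n'n.
congr Some; apply/eqP; rewrite eqn_leq nmin ?kE//= leqNgt.
by apply/negP => nk; exact: kmin nk nE.
Qed.

Lemma coalescence_time_local u v k :
  (forall i : int, - k%:Z <= i <= 0 -> u i = v i) ->
  coalescence_time u = Some k -> coalescence_time v = Some k.
Proof.
move=> uv /coalescence_timeP[kE kmin].
have sub n (e : alphabet m) dflt F : (n <= k)%N ->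
    stage_output e dflt F n v 0 = stage_output e dflt F n u 0.
  move=> nk; apply: stage_output_local => i /andP[ni i0]; apply/esym/uv.
  by rewrite i0 andbT (le_trans _ ni)// lerN2 lez_nat.
have su n (nk : (n <= k)%N) := sub n ord_max false (up_update P) nk.
have sl n (nk : (n <= k)%N) := sub n ord0 true (low_update P) nk.
apply/coalescence_timeP; split=> [|n nk].
  by rewrite (su k (leqnn k)) (sl k (leqnn k)); exact: kE.
by rewrite (su n (ltnW nk)) (sl n (ltnW nk)); exact: kmin.
Qed.

(** The stages of the lower chain are below its limit, which is below the limit of the
upper chain, which is below its own stages. *)
Lemma up_at_coalescence u k : coalescence_time u = Some k -> up u 0 = stage_up k u 0.
Proof.
move=> /coalescence_timeP[kE _]; apply/val_inj/eqP.
rewrite eqn_leq up_le_stage kE /=.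
exact: leq_trans (stage_le_low k u) (low_le_up u).
Qed.

Lemma low_eq_up_coalescence u : up u 0 = low u 0 -> coalescence_time u <> None.
Proof.
move=> ul; rewrite /coalescence_time; case: pselect => // nex _; apply: nex.
have [n [/= nu nl]] := @filter_ex _ _ _ _ (filterI
  (stage_output_near up_inj up_refl up_dflt up_top up_mono u 0)
  (stage_output_near low_inj low_refl low_dflt low_top low_mono u 0)).
by exists n; rewrite nu nl ul.
Qed.

(** Two ordered variables with the same law on a finite set are almost surely equal:
the tail events are nested and have the same probability. *)
Lemma low_eq_up_ae : {ae @symbol_law R, forall u, low u 0 = up u 0}.
Proof.
pose A (a : nat) := [set u : seq_space int symbol | (a <= up u 0)%N] `\`
  [set u | (a <= low u 0)%N].
have mpath (a : nat) : measurable [set w : paths m | (a <= w 0)%N].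
  exact: (@coord_measurable int (alphabet m) 0 (fun b => (a <= b)%N)).
have mup := measurable_output up_inj up_refl up_dflt up_top up_mono.
have mlow := measurable_output low_inj low_refl low_dflt low_top low_mono.
have mU (a : nat) : measurable [set u : seq_space int symbol | (a <= up u 0)%N].
  by have := mup measurableT _ (mpath a); rewrite setTI.
have mL (a : nat) : measurable [set u : seq_space int symbol | (a <= low u 0)%N].
  by have := mlow measurableT _ (mpath a); rewrite setTI.
have A0 (a : nat) : @symbol_law R (A a) = 0%E.
  have EU := output_law Pk Pc up_inj up_refl up_dflt up_top up_mono up_sim
    mu_unique (mpath a).
  have EL := output_law Pk Pc low_inj low_refl low_dflt low_top low_mono low_sim
    mu_unique (mpath a).
  rewrite measureD//; last by rewrite ltey_eq fin_num_measure.
  rewrite setIidr => [|u /= al]; last exact: leq_trans al (low_le_up u).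
  by rewrite [X in (X - _)%E]EU [X in (_ - X)%E]EL subee// fin_num_measure.
have mA a : measurable (A a) by exact: measurableD.
apply: (@negligibleS _ _ _ _ (\bigcup_a A a)).
  move=> u /= ne; exists (up u 0 : nat) => //; split=> /=; first exact: leqnn.
  apply/negP; rewrite -ltnNge ltn_neqAle low_le_up andbT.
  by apply/eqP => /val_inj.
apply: negligible_bigcup => a; exists (A a).
by split; [exact: mA|exact: A0|].
Qed.

Lemma coalescence_cftp :
  feasible_cftp (@symbol_law R) up coalescence_time mu.
Proof.
split.
- exact: (measurable_output up_inj up_refl up_dflt up_top up_mono).
- by move=> u; exact: (output_shift false up_inj up_refl up_top up_mono).
- move=> B mB.
  exact: (output_law Pk Pc up_inj up_refl up_dflt up_top up_mono up_sim mu_unique mB).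
- apply: negligibleS low_eq_up_ae => u /= /contrapT none E; move: none.
  exact/low_eq_up_coalescence/esym.
- move=> k; apply: local_sigma.
    apply: (@finite_coords_measurable int symbol [seq - i%:Z | i <- iota 0 k.+1]).
      exact: countableP.
    move=> u v /eq_in_map uv; apply: coalescence_time_local => i /andP[ki i0].
    apply: uv; apply/mapP; exists `|i|%N; last by rewrite abszE ler0_norm// opprK.
    by rewrite mem_iota /= add0n ltnS -lez_nat abszE ler0_norm// lerNl.
  move=> u v uv; apply: coalescence_time_local => i /andP[ki i0].
  by apply: uv; split.
- move=> u v; case E : (coalescence_time u) => [k|] uv.
    have uv' (i : int) : - k%:Z <= i <= 0 -> u i = v i.
      by move=> /andP[ki i0]; apply: uv; split.
    rewrite (up_at_coalescence E) (up_at_coalescence (coalescence_time_local uv' E)).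
    exact: stage_output_local.
  apply: (output_local false up_inj up_refl up_top up_mono) => i i0.
  by apply: uv; split.
Qed.

End coalescence.

Theorem theorem2 (R : realType) (m : nat) (P : alphabet m -> pasts m -> R)
    (mu : probability (paths m) R) :
  is_kernel P -> attractive P -> continuous_kernel P ->
  unique_compatible_chain P mu ->
  exists (U : pointedType) (Q : probability (seq_space int U) R)
         (Phi : seq_space int U -> paths m)
         (theta : seq_space int U -> option nat),
    [/\ countable [set: U], iid_law Q & feasible_cftp Q Phi theta mu].
Proof.
move=> Pk Pa Pc mu_unique.
exists symbol, symbol_law, (output ord_max false (up_update P)), (coalescence_time P).
split; first exact: countableP.
- exact: symbol_law_iid.
- exact: coalescence_cftp.
Qed.
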